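(* Let $\mathcal B$ be the set of bad edges in the Cayley complex $X$ with respect to the nested traversal 0-combing. Suppose that (1) there is a partial ordering of $\mathcal B$ such that for every $e\in\mathcal B$ the set $\{f\in\mathcal B: f<e\}$ is finite, and (2) there is a function $c$ from $\mathcal B$ to the set of 2-cells of $X$ such that for every $e\in\mathcal B$ the edge $e$ lies on the boundary of $c(e)$, and whenever $f\in\mathcal B$ is another edge on the boundary of $c(e)$, then $f<e$. Then the nested traversal 0-combing $\Psi:X^0\times[0,1]\to X^1$ can be extended to a 1-combing $\Psi:X^1\times[0,1]\to X$.
   Context: $F$ is Thompson's group with presentation $\langle x_0,x_1\mid [x_0x_1^{-1},x_0^{-1}x_1x_0],[x_0x_1^{-1},x_0^{-2}x_1x_0^2]\rangle$, and $X$ is the Cayley 2-complex of this presentation, $X^0=F$, $X^1$ the Cayley graph, $\epsilon$ the identity. A 0-combing is a continuous $\Psi:X^0\times[0,1]\to X^1$ with $\Psi(x,0)=\epsilon$, $\Psi(x,1)=x$; a 1-combing is a continuous $\Psi:X^1\times[0,1]\to X$ with $\Psi(x,0)=\epsilon$, $\Psi(x,1)=x$ and $\Psi(X^0\times[0,1])\subseteq X^1$. The nested traversal 0-combing sends $w\in F$ to the path $\Psi_w$ in $X^1$ from $\epsilon$ to $w$ labelled by the nested traversal normal form $\eta(w)$, defined as follows. Elements of $F$ are represented by reduced tree pair diagrams $(T_-(w),T_+(w))$ of rooted binary trees with $N(w)$ carets each (carets numbered in infix order from 1); a caret is a right (left) caret if one of its edges lies on the right (left) side of the tree, the root being both, other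 carets interior. Nested traversal word $\gamma(T)$ of a tree $T$: go through carets in infix order, skipping carets in the right subtree of a caret to which rule (3) or (5) has been applied, appending: (1) nothing for caret number 1; (2) $x_0^{-1}$ for a left caret with number $>1$; (3) $x_0^{-1}\gamma(T')x_0x_1^{-1}$ for an interior caret with nonempty right subtree $T'$ (regarded as a tree on its own); (4) $x_1^{-1}$ for an interior caret with empty right subtree; (5) $x_0^{-1}\gamma(T')x_0$ for a non-root right caret whose right subtree $T'$ contains an interior caret; (6) nothing for a non-root right caret whose right subtree has no interior caret. Then $\eta(w)$ is the free reduction of $\gamma(T_+(w))^{-1}\gamma(T_-(w))$. For $a\in\{0,1\}$ and $w\in F$, $e_a(w)$ denotes the edge with endpoints $w$ and $wx_a^{-1}$. The edge $e_a(w)$ is good if the loop $\Psi_w\, e_a(w)\,\Psi_{wx_a^{-1}}^{-1}$ is homotopic to the trivial loop in the Cayley graph $X^1$, and bad otherwise.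
   Formalization: In rules (3) and (5), carets of T' keep their type (left, right, interior) and numbering from the whole tree, rather than T' being regarded as a tree on its own; with the latter reading η(w) need not represent w, so Ψ would be undefined. *)

(* Defs.v *)
From HB Require Import structures.
From mathcomp Require Import all_boot all_order all_algebra.
From mathcomp Require Import boolp classical_sets functions cardinality reals.
From mathcomp Require Import topology normedtype.

Set Implicit Arguments.
Unset Strict Implicit.
Unset Printing Implicit Defensive.

Import Order.TTheory GRing.Theory Num.Theory.
Import numFieldNormedType.Exports.
Local Open Scope classical_set_scope.
Local Open Scope ring_scope.

Inductive tree := Leaf | Node of tree & tree.

Fixpoint carets (t : tree) : nat :=
  match t with Leaf => 0 | Node l r => (carets l + carets r).+1 end.

Fixpoint tunion (a b : tree) : tree :=
  match a, b with
  | Leaf, _ => b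
  | _, Leaf => a
  | Node a1 a2, Node b1 b2 => Node (tunion a1 b1) (tunion a2 b2)
  end.

Fixpoint tdiffs (b u : tree) : seq tree :=
  match b, u with
  | Leaf, _ => [:: u]
  | Node _ _, Leaf => [::]
  | Node b1 b2, Node u1 u2 => tdiffs b1 u1 ++ tdiffs b2 u2
  end.

Fixpoint graft_aux (a : tree) (l : seq tree) : tree * seq tree :=
  match a with
  | Leaf => if l is x :: l' then (x, l') else (Leaf, [::])
  | Node a1 a2 =>
      let (a1', l1) := graft_aux a1 l in
      let (a2', l2) := graft_aux a2 l1 in (Node a1' a2', l2)
  end.
Definition graft (a : tree) (l : seq tree) : tree := (graft_aux a l).1.

(** exposed carets (both children leaves), indexed by the number (from 0)
    of their left leaf; second component: number of leaves *)
Fixpoint exposed (t : tree) (i : nat) : seq nat * nat :=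
  match t with
  | Leaf => ([::], 1%N)
  | Node Leaf Leaf => ([:: i], 2%N)
  | Node a b =>
      let (e1, n1) := exposed a i in
      let (e2, n2) := exposed b (i + n1) in (e1 ++ e2, (n1 + n2)%N)
  end.

Fixpoint collapse (t : tree) (i j : nat) : tree * nat :=
  match t with
  | Leaf => (Leaf, 1%N)
  | Node Leaf Leaf => if i == j then (Leaf, 1%N) else (t, 2%N)
  | Node a b =>
      let (a', n1) := collapse a i j in
      let (b', n2) := collapse b i (j + n1) in (Node a' b', (n1 + n2)%N)
  end.

(** A tree pair diagram (T_-, T_+) : the element maps the leaf intervals of
    T_- (source) in order onto those of T_+ (target). *)
Definition tpair := (tree * tree)%type.

Definition common_exposed (p : tpair) : seq nat :=
  [seq i <- (exposed p.1 0).1 | i \in (exposed p.2 0).1].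

Fixpoint reduce_fuel (n : nat) (p : tpair) : tpair :=
  match n with
  | 0 => p
  | n'.+1 =>
      if common_exposed p is i :: _ then
        reduce_fuel n' ((collapse p.1 i 0).1, (collapse p.2 i 0).1)
      else p
  end.
Definition reduce (p : tpair) : tpair := reduce_fuel (carets p.1).+1 p.

Definition reducedb (p : tpair) : bool :=
  (carets p.1 == carets p.2) && nilp (common_exposed p).

(** Thompson's group F: reduced tree pair diagrams *)
Definition F := {p : tpair | reducedb p}.

Definition Tminus (w : F) : tree := (sval w).1.
Definition Tplus (w : F) : tree := (sval w).2.

(** composition f o g (first g, then f) of tree pair diagrams *)
Definition tcomp (f g : tpair) : tpair :=
  let u := tunion g.2 f.1 in
  (graft g.1 (tdiffs g.2 u), graft f.2 (tdiffs f.1 u)).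

Definition Fid : F := exist _ (Leaf, Leaf) (erefl true).

Definition mkF (p : tpair) : F :=
  (if reducedb p as b return reducedb p = b -> F
   then fun h => exist _ p h else fun _ => Fid) erefl.
Definition Fmul (g h : F) : F := mkF (reduce (tcomp (sval g) (sval h))).

Definition rvine2 := Node Leaf (Node Leaf Leaf).
Definition lvine2 := Node (Node Leaf Leaf) Leaf.
Definition x1src := Node Leaf (Node Leaf (Node Leaf Leaf)).
Definition x1tgt := Node Leaf (Node (Node Leaf Leaf) Leaf).

(** generators: [gen false] = x_0, [gen true] = x_1, and their inverses *)
Definition gen (a : bool) : F :=
  if a then exist _ (x1src, x1tgt) (erefl true)
  else exist _ (rvine2, lvine2) (erefl true).
Definition geninv (a : bool) : F :=
  if a then exist _ (x1tgt, x1src) (erefl true)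
  else exist _ (lvine2, rvine2) (erefl true).

(** words: a letter (a, true) is x_a, a letter (a, false) is x_a^{-1} *)
Definition letter := (bool * bool)%type.
Definition word := seq letter.

Definition lval (l : letter) : F := if l.2 then gen l.1 else geninv l.1.

Fixpoint evalw_from (g : F) (w : word) : F :=
  if w is l :: w' then evalw_from (Fmul g (lval l)) w' else g.

Definition winv (w : word) : word := rev [seq (l.1, ~~ l.2) | l <- w].

Definition freered (w : word) : word :=
  rev (foldl (fun st x =>
    if st is y :: st' then
      if (y.1 == x.1) && (y.2 == ~~ x.2) then st' else x :: st
    else [:: x]) [::] w).

Definition x0 : letter := (false, true).
Definition x0i : letter := (false, false).
Definition x1 : letter := (true, true).
Definition x1i : letter := (true, false).

(** the tree has no interior caret below it when it hangs on the right side *)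
Fixpoint rvine (t : tree) : bool :=
  match t with Leaf => true | Node Leaf r => rvine r | Node _ _ => false end.

(** Nested traversal word.  [trav t ls rs] processes the carets of the
    subtree [t] in infix order; [ls] ([rs]) says whether the root of [t] lies
    on the left (right) side of the whole tree.  A caret is a left caret iff
    it lies on the left side, a right caret iff on the right side, interior
    otherwise; caret number 1 is the left caret with empty left subtree.
    After rule (3) or (5) the right subtree is not traversed any further. *)
Fixpoint trav (t : tree) (ls rs : bool) : word :=
  match t with
  | Leaf => [::]
  | Node l r =>
      trav l ls false ++
      (if ls then
         (if l is Leaf then [::] else [:: x0i])       (* rules (1), (2) *)
         ++ trav r false rs
       else if ~~ rs then
         (if r is Leaf then [:: x1i]                   (* rule (4) *)
          else [:: x0i] ++ trav r false false ++ [:: x0; x1i]) (* rule (3) *)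
       else if ~~ rvine r then
         [:: x0i] ++ trav r false true ++ [:: x0]      (* rule (5) *)
       else trav r false true)                          (* rule (6) *)
  end.

Definition gamma (t : tree) : word := trav t true true.

Definition eta (w : F) : word := freered (winv (gamma (Tplus w)) ++ gamma (Tminus w)).

Definition commw (a b : word) : word := a ++ b ++ winv a ++ winv b.
Definition relator (r : bool) : word :=
  if r then commw [:: x0; x1i] [:: x0i; x0i; x1; x0; x0]
  else commw [:: x0; x1i] [:: x0i; x1; x0].

(** points of the 1-skeleton X^1 (Cayley graph): vertices, and interior
    points of the edge from g to g x_a (parameter t in (0,1)) *)
Inductive X1 (R : realType) :=
  | V of F
  | E of F & bool & {t : R | 0 < t < 1}.

(** points of X: the points of X^1 and interior points of the 2-cells;
    the 2-cell (g, r) is attached along the loop reading [relator r] from g.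
    Its interior is an open disk in polar-like coordinates: center [Fc g r],
    and [Fi g r s rho] with angle parameter s in [0,1) and radius rho in (0,1). *)
Inductive X2 (R : realType) :=
  | P1 of X1 R
  | Fc of F & bool
  | Fi of F & bool & {s : R | 0 <= s < 1} & {rho : R | 0 < rho < 1}.

Arguments V {R}.
Arguments E {R}.
Arguments P1 {R}.
Arguments Fc {R}.
Arguments Fi {R}.

HB.instance Definition _ (R : realType) := gen_eqMixin (X1 R).
HB.instance Definition _ (R : realType) := gen_choiceMixin (X1 R).
HB.instance Definition _ (R : realType) := gen_eqMixin (X2 R).
HB.instance Definition _ (R : realType) := gen_choiceMixin (X2 R).

Section CayleyComplex.
Context {R : realType}.

Definition epoint (g : F) (a : bool) (s : R) : X1 R :=
  match insub s with
  | Some s' => E g a s'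
  | None => if s <= 0 then V g else V (Fmul g (gen a))
  end.

Definition lpoint (h : F) (l : letter) (s : R) : X1 R :=
  if l.2 then epoint h l.1 s else epoint (Fmul h (geninv l.1)) l.1 (1 - s).

Definition wpath (g : F) (w : word) (t : R) : X1 R :=
  let n := size w in
  if n is 0 then V g
  else
    let k := minn (Num.truncn (t * n%:R)) n.-1 in
    lpoint (evalw_from g (take k w)) (nth x0 w k) (t * n%:R - k%:R).

Lemma s0_subproof : (0 <= (0 : R)) && ((0 : R) < 1).
Proof. by rewrite lexx ltr01. Qed.
Definition s0 : {s : R | 0 <= s < 1} := exist _ 0 s0_subproof.

(** characteristic map of the 2-cell (g, r), defined on the square [0,1]^2:
    (s, 1) goes to the boundary loop, (s, 0) to the center, and (0,rho),
    (1,rho) are identified *)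
Definition face (g : F) (r : bool) (p : R * R) : X2 R :=
  if 1 <= p.2 then P1 (wpath g (relator r) p.1)
  else match insub p.2 with
       | None => Fc g r
       | Some rho => match insub p.1 with
                     | Some s => Fi g r s rho
                     | None => Fi g r s0 rho
                     end
       end.

Definition I01 : set R := [set t | 0 <= t <= 1].
Definition sq01 : set (R * R) := [set p | 0 <= p.1 <= 1 /\ 0 <= p.2 <= 1].

Definition X1_open (U : set (X1 R)) : Prop :=
  forall g a, @open (subspace I01) (epoint g a @^-1` U).

Definition X2_open (U : set (X2 R)) : Prop :=
  X1_open (P1 @^-1` U) /\
  forall g r, @open (subspace sq01) (face g r @^-1` U).

Lemma X1_openT : X1_open setT.
Proof. by move=> g a; rewrite preimage_setT; exact: openT. Qed.

Lemma X1_openI : setI_closed X1_open.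
Proof. by move=> A B oA oB g a; rewrite preimage_setI; exact: openI. Qed.

Lemma X1_open_bigU (I : Type) (f : I -> set (X1 R)) :
  (forall i, X1_open (f i)) -> X1_open (\bigcup_i f i).
Proof.
by move=> oF g a; rewrite preimage_bigcup; apply: bigcup_open => i _; exact: oF.
Qed.

Lemma X2_openT : X2_open setT.
Proof.
split; first by rewrite preimage_setT; exact: X1_openT.
by move=> g r; rewrite preimage_setT; exact: openT.
Qed.

Lemma X2_openI : setI_closed X2_open.
Proof.
move=> A B [oA fA] [oB fB]; split; first by rewrite preimage_setI; exact: X1_openI.
by move=> g r; rewrite preimage_setI; exact: openI.
Qed.

Lemma X2_open_bigU (I : Type) (f : I -> set (X2 R)) :
  (forall i, X2_open (f i)) -> X2_open (\bigcup_i f i).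
Proof.
move=> oF; split.
  by rewrite preimage_bigcup; apply: X1_open_bigU => i; case: (oF i).
move=> g r; rewrite preimage_bigcup; apply: bigcup_open => i _.
by case: (oF i) => _; apply.
Qed.

End CayleyComplex.

HB.instance Definition _ (R : realType) :=
  isOpenTopological.Build (X1 R) (@X1_openT R) (@X1_openI R) (@X1_open_bigU R).
HB.instance Definition _ (R : realType) :=
  isOpenTopological.Build (X2 R) (@X2_openT R) (@X2_openI R) (@X2_open_bigU R).

Section Combings.
Context {R : realType}.

Definition Psi0 (w : F) (t : R) : X1 R := wpath Fid (eta w) t.

Definition is_1combing (Psi : X1 R * R -> X2 R) : Prop :=
  [/\ {within [set p : X1 R * R | 0 <= p.2 <= 1], continuous Psi},
      (forall x, Psi (x, 0) = P1 (V Fid)),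
      (forall x, Psi (x, 1) = P1 x) &
      (forall w t, 0 <= t <= 1 -> exists y, Psi (V w, t) = P1 y)].

Definition extends_Psi0 (Psi : X1 R * R -> X2 R) : Prop :=
  forall w t, 0 <= t <= 1 -> Psi (V w, t) = P1 (Psi0 w t).

Definition pconcat {T : Type} (p q : R -> T) (t : R) : T :=
  if t <= 2^-1 then p (2 * t) else q (2 * t - 1).
Definition preverse {T : Type} (p : R -> T) (t : R) : T := p (1 - t).

Definition null_homotopic {T : topologicalType} (gam : R -> T) (x : T) : Prop :=
  exists H : R * R -> T,
    [/\ {within sq01, continuous H},
        (forall s, 0 <= s <= 1 -> H (s, 0) = gam s),
        (forall s, 0 <= s <= 1 -> H (s, 1) = x) &
        (forall t, 0 <= t <= 1 -> H (0, t) = x /\ H (1, t) = x)].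

(** e_a(w): the edge with endpoints w and w x_a^{-1}, traversed from w *)
Definition edge_path (w : F) (a : bool) : R -> X1 R :=
  lpoint w (a, false).

Definition good_loop (w : F) (a : bool) : R -> X1 R :=
  pconcat (Psi0 w) (pconcat (edge_path w a) (preverse (Psi0 (Fmul w (geninv a))))).

(** edges: (w, a) stands for e_a(w) *)
Definition edge := (F * bool)%type.

Definition good_edge (e : edge) : Prop := null_homotopic (good_loop e.1 e.2) (V Fid).
Definition bad_edge (e : edge) : Prop := ~ good_edge e.

End Combings.

(** 2-cells of X: (g, r) is the cell attached along [relator r] read from g *)
Definition cell := (F * bool)%type.

Fixpoint path_edges (g : F) (w : word) : seq edge :=
  if w is l :: w' then
    (if l.2 then (Fmul g (gen l.1), l.1) else (g, l.1)) :: path_edges (Fmul g (lval l)) w'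
  else [::].

Fixpoint In_seq {T : Type} (x : T) (s : seq T) : Prop :=
  if s is y :: s' then y = x \/ In_seq x s' else False.

Definition on_boundary (e : edge) (c : cell) : Prop :=
  In_seq e (path_edges c.1 (relator c.2)).

(* Main.v *)
(** Read left to right, the letters of a word compose as maps, so a tree pair is made to act on
    binary streams by replacing its i-th source leaf by its i-th target leaf. Reduced pairs with
    the same action are equal: the carets of the source tree of a reduced pair sit exactly over
    the dyadic intervals on which the map is not affine. All identities in F thus become
    identities between maps of streams; in particular [gamma T] acts as the map carrying the
    tree [T] to a right vine, whence [eta w] is a word for [w].

    Call an edge filled if its loop [Psi_w e Psi_w'^-1] is null-homotopic in X. Good edges are
    filled. The boundary of a 2-cell is an embedded circuit which is null-homotopic in X, so in
    the fundamental groupoid an edge is filled as soon as all other edges of one of its 2-cells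
    are. Since a bad edge has finitely many bad edges below it, induction on their number fills
    every edge. A filled edge bounds a square with sides the edge, its two combing paths and the
    base point, and these squares agree on vertices, so they glue to the 1-combing. *)
Require Import Defs.
From HB Require Import structures.
From mathcomp Require Import all_boot all_order all_algebra.
From mathcomp Require Import finmap.
From mathcomp Require Import boolp classical_sets functions cardinality reals.
From mathcomp Require Import topology normedtype.
From mathcomp Require Import zify ring lra.

Set Implicit Arguments.
Unset Strict Implicit.
Unset Printing Implicit Defensive.

(** * Tree pairs acting on binary streams *)

Definition stream := nat -> bool.
Definition scons (b : bool) (s : stream) : stream :=
  fun n => if n is m.+1 then s m else b.
Definition stail (s : stream) : stream := fun n => s n.+1.

Lemma stail_scons b s : stail (scons b s) = s.
Proof. by []. Qed.

Lemma scons_stail s : scons (s 0) (stail s) = s.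
Proof. by apply: funext => -[]. Qed.

Lemma streamP (P : stream -> Prop) :
  (forall s, P (scons false s)) -> (forall s, P (scons true s)) -> forall s, P s.
Proof. by move=> P0 P1 s; rewrite -(scons_stail s); case: (s 0). Qed.

Lemma scons_inj b s s' : scons b s = scons b s' -> s = s'.
Proof. by move=> e; rewrite -[s](stail_scons b) e. Qed.

Definition prepend (u : seq bool) (s : stream) : stream := foldr scons s u.

Lemma prepend_cat u v s : prepend (u ++ v) s = prepend u (prepend v s).
Proof. by rewrite /prepend foldr_cat. Qed.

Lemma prepend_inj u v : (forall s, prepend u s = prepend v s) -> u = v.
Proof.
have nil_cons b w : ~ (forall s, s = scons b (prepend w s)).
  by move/(_ (fun=> ~~ b))/(congr1 (fun s : stream => s 0)) => /=; case: b.
elim: u v => [|b u IH] [|b' v] //= e.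
- by case: (nil_cons b' v).
- by case: (nil_cons b u) => s; rewrite -[LHS]e.
- have eb : b = b' by move/(_ (fun=> b))/(congr1 (fun s : stream => s 0)): e.
  by rewrite eb (IH v) // => s; apply: (@scons_inj b); rewrite e eb.
Qed.

Definition leaves (t : tree) : nat := (carets t).+1.

Lemma leaves_Node a b : leaves (Node a b) = leaves a + leaves b.
Proof. by rewrite /leaves /= addnS addSn. Qed.

Fixpoint locate (t : tree) (s : stream) : nat * stream :=
  match t with
  | Leaf => (0, s)
  | Node a b =>
      if s 0 then let p := locate b (stail s) in (leaves a + p.1, p.2)
      else locate a (stail s)
  end.

Fixpoint addr (t : tree) (i : nat) : seq bool :=
  match t with
  | Leaf => [::]
  | Node a b =>
      if i < leaves a then false :: addr a i else true :: addr b (i - leaves a)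
  end.

Definition plug (t : tree) (i : nat) (s : stream) : stream := prepend (addr t i) s.

Lemma plug_Node a b i s :
  plug (Node a b) i s =
  if i < leaves a then scons false (plug a i s)
  else scons true (plug b (i - leaves a) s).
Proof. by rewrite /plug /=; case: ifP. Qed.

Lemma locate_lt t s : (locate t s).1 < leaves t.
Proof.
elim: t s => [//|a IHa b IHb] s; rewrite leaves_Node /=.
by case: (s 0) => /=; [rewrite ltn_add2l | apply: ltn_addr].
Qed.

Lemma locateK t s : plug t (locate t s).1 (locate t s).2 = s.
Proof.
elim: t s => [//|a IHa b IHb]; elim/streamP => s.
  by rewrite plug_Node /= locate_lt IHa.
by rewrite plug_Node /= ltnNge leq_addr /= addKn IHb.
Qed.

Lemma plugK t i s : i < leaves t -> locate t (plug t i s) = (i, s).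
Proof.
elim: t i => [|a IHa b IHb] i; first by case: i.
rewrite leaves_Node plug_Node; case: (ltnP i (leaves a)) => /= [ia _|ai ib].
  by rewrite IHa.
by rewrite IHb ?ltn_subLR //= subnKC.
Qed.

Definition tact (p : tpair) (s : stream) : stream :=
  plug p.2 (locate p.1 s).1 (locate p.1 s).2.

Lemma tact_trans S T U : leaves S = leaves T ->
  tact (T, U) \o tact (S, T) = tact (S, U).
Proof.
by move=> e; apply: funext => s; rewrite /tact /= plugK // -e locate_lt.
Qed.

Lemma tact_id T : tact (T, T) = id.
Proof. by apply: funext => s; exact: locateK. Qed.

Lemma split_size (T : Type) (l : seq T) m n : size l = m + n ->
  exists l1 l2, [/\ l = l1 ++ l2, size l1 = m & size l2 = n].
Proof.
move=> sl; exists (take m l), (drop m l).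
by rewrite cat_take_drop size_takel ?size_drop sl ?addKn ?leq_addr.
Qed.

Lemma graft_aux_cat a l1 l2 : size l1 = leaves a ->
  graft_aux a (l1 ++ l2) = (graft a l1, l2).
Proof.
rewrite /graft; elim: a l1 l2 => [|a IHa b IHb] l1 l2.
  by case: l1 => [|x []].
rewrite leaves_Node => /split_size[k1 [k2 [-> s1 s2]]].
by rewrite -catA /= !IHa // IHb // -[k2 in RHS]cats0 IHb.
Qed.

Lemma graft_Node a b l1 l2 : size l1 = leaves a -> size l2 = leaves b ->
  graft (Node a b) (l1 ++ l2) = Node (graft a l1) (graft b l2).
Proof.
by move=> s1 s2; rewrite {1}/graft /= graft_aux_cat // -[l2 in LHS]cats0 graft_aux_cat.
Qed.

Lemma leaves_graft a l : size l = leaves a ->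
  leaves (graft a l) = sumn (map leaves l).
Proof.
elim: a l => [|a IHa b IHb] l.
  by case: l => [|x []] //= _; rewrite addn0.
rewrite leaves_Node => /split_size[l1 [l2 [-> s1 s2]]].
by rewrite graft_Node // leaves_Node IHa // IHb // map_cat sumn_cat.
Qed.

Definition graft_index (l : seq tree) (q : nat * stream) : nat * stream :=
  let r := locate (nth Leaf l q.1) q.2 in
  (sumn (map leaves (take q.1 l)) + r.1, r.2).

Lemma locate_graft a l s : size l = leaves a ->
  locate (graft a l) s = graft_index l (locate a s).
Proof.
rewrite /graft_index; elim: a l s => [|a IHa b IHb] l s.
  by case: l => [|x []] //= _; case: (locate x s).
rewrite leaves_Node => /split_size[l1 [l2 [-> s1 s2]]].
rewrite graft_Node //=; case: (s 0) => /=.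
  rewrite IHb //= nth_cat s1 ltnNge leq_addr /= addKn take_cat s1 ltnNge leq_addr /=.
  by rewrite addKn map_cat sumn_cat leaves_graft // addnA.
by rewrite IHa // nth_cat take_cat s1 locate_lt.
Qed.

Lemma plug_graft a l q : size l = leaves a -> q.1 < leaves a ->
  plug (graft a l) (graft_index l q).1 (graft_index l q).2 = plug a q.1 q.2.
Proof.
move=> sl lq; have <- : graft_index l (locate a (plug a q.1 q.2)) = graft_index l q.
  by rewrite plugK //; case: q {lq}.
by rewrite -locate_graft // locateK.
Qed.

Lemma tact_graft S T l : size l = leaves S -> leaves S = leaves T ->
  tact (graft S l, graft T l) = tact (S, T).
Proof.
move=> sl e; apply: funext => s.
by rewrite /tact /= locate_graft // plug_graft // -e // locate_lt.
Qed.

Lemma size_tdiffs_tunion a b : size (tdiffs a (tunion a b)) = leaves a.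
Proof.
by elim: a b => [|a1 IH1 a2 IH2] [|b1 b2] //=; rewrite size_cat leaves_Node ?IH1 ?IH2 //;
  rewrite -{1}(IH1 Leaf) -(IH2 Leaf); case: (a1); case: (a2).
Qed.

Lemma tunionC a b : tunion a b = tunion b a.
Proof. by elim: a b => [|a1 IH1 a2 IH2] [|b1 b2] //=; rewrite IH1 IH2. Qed.

Lemma tunion_Leafr a : tunion a Leaf = a.
Proof. by case: a. Qed.

Lemma graft_tdiffs a b : graft a (tdiffs a (tunion a b)) = tunion a b.
Proof.
elim: a b => [|a1 IH1 a2 IH2] b //.
have [u1 [u2 [-> h1 h2]]] : exists u1 u2,
    [/\ tunion (Node a1 a2) b = Node (tunion a1 u1) (tunion a2 u2), True & True].
  by case: b => [|b1 b2]; [exists Leaf, Leaf; rewrite !tunion_Leafr | exists b1, b2].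
by rewrite /= graft_Node ?size_tdiffs_tunion // IH1 IH2.
Qed.

Lemma tcomp_spec f g : carets f.1 = carets f.2 -> carets g.1 = carets g.2 ->
  carets (tcomp f g).1 = carets (tcomp f g).2 /\
  tact (tcomp f g) = tact f \o tact g.
Proof.
case: f g => [f1 f2] [g1 g2] /= ef eg; rewrite /tcomp /=.
set u := tunion g2 f1.
have sg : size (tdiffs g2 u) = leaves g2 by rewrite size_tdiffs_tunion.
have sf : size (tdiffs f1 u) = leaves f1 by rewrite /u tunionC size_tdiffs_tunion.
have gg : graft g2 (tdiffs g2 u) = u by rewrite graft_tdiffs.
have gf : graft f1 (tdiffs f1 u) = u by rewrite /u tunionC graft_tdiffs.
have elg : leaves g1 = leaves g2 by rewrite /leaves eg.
have elf : leaves f1 = leaves f2 by rewrite /leaves ef.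
have lg : leaves (graft g1 (tdiffs g2 u)) = leaves u.
  by rewrite -{2}gg !leaves_graft ?sg.
have lf : leaves (graft f2 (tdiffs f1 u)) = leaves u.
  by rewrite -{2}gf !leaves_graft ?sf.
split; first by move: lg; rewrite -lf => -[].
have <- : tact (u, graft f2 (tdiffs f1 u)) = tact (f1, f2).
  by rewrite -{1}gf tact_graft.
have <- : tact (graft g1 (tdiffs g2 u), u) = tact (g1, g2).
  by rewrite -{2}gg tact_graft // sg.
by rewrite tact_trans // lg.
Qed.

Definition xcarets (t : tree) : seq nat := (exposed t 0).1.

Lemma exposed_NodeE a b j : exposed (Node a b) j =
  if (a, b) is (Leaf, Leaf) then ([:: j], 2)
  else ((exposed a j).1 ++ (exposed b (j + (exposed a j).2)).1,
        (exposed a j).2 + (exposed b (j + (exposed a j).2)).2).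
Proof.
transitivity (if (a, b) is (Leaf, Leaf) then ([:: j], 2) else
    let (e1, n1) := exposed a j in
    let (e2, n2) := exposed b (j + n1) in (e1 ++ e2, n1 + n2)).
  by case: a => [|? ?]; case: b.
by case: (exposed a j) => e1 n1 /=; case: (exposed b _).
Qed.

Lemma exposedE t j : exposed t j = ([seq j + i | i <- xcarets t], leaves t).
Proof.
rewrite /xcarets; elim: t j => [//|a IHa b IHb] j; rewrite !exposed_NodeE leaves_Node.
have H : ((exposed a j).1 ++ (exposed b (j + (exposed a j).2)).1,
        (exposed a j).2 + (exposed b (j + (exposed a j).2)).2) =
     ([seq j + i | i <- (exposed a 0).1 ++ (exposed b (0 + (exposed a 0).2)).1],
        leaves a + leaves b).
  rewrite (IHa j) (IHa 0) /= add0n (IHb (j + _)) (IHb (leaves a)) /= map_cat -!map_comp.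
  congr (_ ++ _, _); by apply: eq_map => i //=; rewrite addnA.
case: a IHa H => [|a1 a2] IHa; case: b IHb => [|b1 b2] IHb // _.
by rewrite /= addn0.
Qed.

Lemma xcarets_Node a b : xcarets (Node a b) =
  if (a, b) is (Leaf, Leaf) then [:: 0]
  else xcarets a ++ [seq leaves a + i | i <- xcarets b].
Proof.
have E : (exposed b (0 + (exposed a 0).2)).1 = [seq leaves a + i | i <- xcarets b].
  by rewrite (exposedE a) /= add0n exposedE.
by rewrite [LHS]/xcarets exposed_NodeE E; case: a E => [|? ?]; case: b.
Qed.

Lemma Node_cases a b : a = Leaf /\ b = Leaf \/
  forall (T : Type) (x y : T), (if (a, b) is (Leaf, Leaf) then x else y) = y.
Proof. by case: a => [|? ?]; case: b => [|? ?]; auto. Qed.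

Lemma xcarets_lt t (i : nat) : i \in xcarets t -> i.+1 < leaves t.
Proof.
elim: t i => [//|a IHa b IHb] i; rewrite xcarets_Node leaves_Node.
case: (Node_cases a b) => [[-> ->]|->]; first by rewrite inE => /eqP->.
rewrite mem_cat => /orP[/IHa|/mapP[k /IHb]]; first by lia.
by move=> ? ->; lia.
Qed.

Fixpoint merge_caret (t : tree) (i : nat) : tree :=
  match t with
  | Leaf => Leaf
  | Node a b =>
      if (a, b) is (Leaf, Leaf) then Leaf
      else if i < leaves a then Node (merge_caret a i) b
      else Node a (merge_caret b (i - leaves a))
  end.

Lemma collapse_NodeE a b i j : collapse (Node a b) i j =
  if (a, b) is (Leaf, Leaf) then if i == j then (Leaf, 1) else (Node a b, 2)
  else (Node (collapse a i j).1 (collapse b i (j + (collapse a i j).2)).1,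
        (collapse a i j).2 + (collapse b i (j + (collapse a i j).2)).2).
Proof.
transitivity (if (a, b) is (Leaf, Leaf) then
      if i == j then (Leaf, 1) else (Node a b, 2) else
    let (a', n1) := collapse a i j in
    let (b', n2) := collapse b i (j + n1) in (Node a' b', n1 + n2)).
  by case: a => [|? ?]; case: b.
by case: (collapse a i j) => a' n1 /=; case: (collapse b _ _).
Qed.

Lemma collapse_out t i j : (forall k, k \in xcarets t -> i <> j + k) ->
  collapse t i j = (t, leaves t).
Proof.
elim: t i j => [//|a IHa b IHb] i j; rewrite xcarets_Node collapse_NodeE leaves_Node.
case: (Node_cases a b) => [[-> ->]|E] H.
  by case: eqP => // e; case: (H 0); rewrite ?inE ?addn0.
rewrite E IHa => [|k ka]; last by apply: H; rewrite E mem_cat ka.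
rewrite IHb //= => k kb; rewrite -addnA; apply: H.
by rewrite E mem_cat map_f ?orbT.
Qed.

Lemma collapse_in t (i j : nat) : i \in xcarets t ->
  collapse t (j + i) j = (merge_caret t i, (leaves t).-1).
Proof.
elim: t i j => [//|a IHa b IHb] i j; rewrite xcarets_Node collapse_NodeE leaves_Node /=.
case: (Node_cases a b) => [[-> ->]|E]; first by rewrite inE => /eqP->; rewrite addn0 eqxx.
rewrite !E mem_cat => /orP[ia|/mapP[k kb ->]].
  have lt_i := xcarets_lt ia; rewrite IHa // collapse_out /=; last first.
    by move=> k _; move: lt_i; rewrite /leaves; lia.
  by rewrite ltnW //; congr (_, _); rewrite /leaves.
rewrite collapse_out /=; last by move=> l /xcarets_lt; lia.
by rewrite addnA IHb //= ltnNge leq_addr /= addKn; congr (_, _); rewrite /leaves; lia.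
Qed.

Lemma carets_merge_caret t (i : nat) : i \in xcarets t ->
  carets t = (carets (merge_caret t i)).+1.
Proof.
elim: t i => [//|a IHa b IHb] i; rewrite xcarets_Node /=.
case: (Node_cases a b) => [[-> ->]//|E]; rewrite !E mem_cat => /orP[ia|/mapP[k kb ->]].
  by rewrite ltnW ?xcarets_lt //= (IHa i).
by rewrite ltnNge leq_addr /= addKn (IHb k) // addnS.
Qed.

Definition merge_index (i : nat) (q : nat * stream) : nat * stream :=
  if q.1 < i then q else if q.1 == i then (i, scons false q.2)
  else if q.1 == i.+1 then (i, scons true q.2) else (q.1.-1, q.2).

Lemma merge_indexD (n i : nat) q :
  merge_index (n + i) (n + q.1, q.2) = (n + (merge_index i q).1, (merge_index i q).2).
Proof.
rewrite /merge_index /= ltn_add2l -addnS !eqn_add2l.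
by case: ltnP => //; case: eqP => //; case: eqP => //= *; congr (_, _); lia.
Qed.

Lemma locate_merge_caret t (i : nat) s : i \in xcarets t ->
  locate (merge_caret t i) s = merge_index i (locate t s).
Proof.
elim: t i s => [//|a IHa b IHb] i; rewrite xcarets_Node /=.
case: (Node_cases a b) => [[-> ->]|E].
  by rewrite inE => + /eqP->; elim/streamP => s.
move=> s; rewrite !E mem_cat => /orP[ia|/mapP[k kb ->]].
  rewrite ltnW ?xcarets_lt //=; case: (s 0) => /=; last by rewrite IHa.
  have lt_i := xcarets_lt ia; have m := carets_merge_caret ia.
  by rewrite /merge_index /= !ifN; [rewrite /leaves m | lia..].
rewrite ltnNge leq_addr /= addKn; case: (s 0); first by rewrite merge_indexD IHb.
rewrite /merge_index ifT //; apply: ltn_addr; exact: locate_lt.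
Qed.

Lemma plug_merge_caret t (i k : nat) s : i \in xcarets t -> k < leaves t ->
  plug (merge_caret t i) (merge_index i (k, s)).1 (merge_index i (k, s)).2 = plug t k s.
Proof.
move=> it kt; have <- : merge_index i (locate t (plug t k s)) = merge_index i (k, s).
  by rewrite plugK.
by rewrite -locate_merge_caret // locateK.
Qed.

Lemma tact_merge_caret S T (i : nat) :
  i \in xcarets S -> i \in xcarets T -> carets S = carets T ->
  tact (merge_caret S i, merge_caret T i) = tact (S, T).
Proof.
move=> iS iT e; apply: funext => s; rewrite /tact /= locate_merge_caret //.
have := locate_lt S s; rewrite /leaves e; case: (locate S s) => k s' /= kl.
by rewrite plug_merge_caret.
Qed.

Lemma reduce_spec p : carets p.1 = carets p.2 ->
  reducedb (reduce p) /\ tact (reduce p) = tact p.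
Proof.
suff H n q : carets q.1 < n -> carets q.1 = carets q.2 ->
    reducedb (reduce_fuel n q) /\ tact (reduce_fuel n q) = tact q by exact: H.
elim: n q => [//|n IH] [S T] /= lt_n e.
case E: (common_exposed (S, T)) => [|i c]; first by rewrite /reducedb e eqxx E.
have : i \in common_exposed (S, T) by rewrite E inE eqxx.
rewrite mem_filter /= => /andP[iT iS].
have cS := carets_merge_caret iS; have cT := carets_merge_caret iT.
rewrite (collapse_in 0 iS : collapse S i 0 = _) (collapse_in 0 iT : collapse T i 0 = _).
by rewrite -(tact_merge_caret iS iT e); apply: IH => /=; lia.
Qed.

(** * Reduced tree pairs are determined by their action *)

Lemma addr_exposed T (i : nat) v : i.+1 < leaves T ->
  addr T i = rcons v false -> addr T i.+1 = rcons v true -> i \in xcarets T.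
Proof.
elim: T i v => [//|a IHa b IHb] i v; rewrite xcarets_Node leaves_Node /=.
case: (ltnP i.+1 (leaves a)) => [lt_i _|le_i].
  rewrite ltnW //; case: v => [|b0 v] /= [].
    by move=> _; case: (addr a i.+1).
  move=> <- e1 [e2]; have ia := IHa _ _ lt_i e1 e2.
  by case: (Node_cases a b) => [[ea _]|->]; [rewrite ea in ia | rewrite mem_cat ia].
case: (ltnP i (leaves a)) => [lt_i lt_b|ai ib].
  case: v => [|b0 v] /= e0 e1; last by case: e0 e1 => <-.
  case: e0 e1 => e0 [e2].
  have {}e0 : a = Leaf by case: (a) e0 => //= ? ?; case: ifP.
  have {}e2 : b = Leaf by case: (b) e2 => //= ? ?; case: ifP.
  by move: lt_i; rewrite e0 e2; case: (i).
case: v => [|b0 v] /= []; first by case: (addr b _).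
move=> <- e1 [e2]; have := IHb (i - leaves a) v; rewrite -subSn // => /(_ _ e1 e2) ib'.
have {}ib' : i - leaves a \in xcarets b by apply: ib'; lia.
case: (Node_cases a b) => [[_ eb]|->]; first by rewrite eb in ib'.
by rewrite mem_cat; apply/orP; right; apply/mapP; exists (i - leaves a); rewrite ?subnKC.
Qed.

Definition act_addr (S : tree) (u : nat -> seq bool) (s : stream) : stream :=
  prepend (u (locate S s).1) (locate S s).2.

Definition unmergeable (S : tree) (u : nat -> seq bool) : Prop :=
  forall i v, i \in xcarets S -> u i = rcons v false -> u i.+1 <> rcons v true.

Lemma unmergeable_Node a b u : unmergeable (Node a b) u ->
  unmergeable a u /\ unmergeable b (fun i => u (leaves a + i)).
Proof.
rewrite /unmergeable xcarets_Node.
case: (Node_cases a b) => [[-> ->] //|->] H; split=> i v ix.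
  by apply: H; rewrite mem_cat ix.
by rewrite addnS; apply: H; rewrite mem_cat map_f ?orbT.
Qed.

(* The internal nodes of a reduced source tree are exactly the dyadic intervals
   on which the map is not affine. *)
Lemma affine_Leaf S u v : unmergeable S u ->
  (forall s, act_addr S u s = prepend v s) -> S = Leaf.
Proof.
elim: S u v => [//|a IHa b IHb] u v H e.
have [ua ub] := unmergeable_Node H.
have ea : forall s, act_addr a u s = prepend (rcons v false) s.
  by move=> s; rewrite -cats1 prepend_cat /= -e.
have eb : forall s, act_addr b (fun i => u (leaves a + i)) s = prepend (rcons v true) s.
  by move=> s; rewrite -cats1 prepend_cat /= -e.
have a0 := IHa _ _ ua ea; have b0 := IHb _ _ ub eb; subst a b.
case: (H 0 v); first by rewrite inE.
  by apply: prepend_inj => s; exact: ea.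
by apply: prepend_inj => s; exact: eb.
Qed.

Lemma unmergeable_inj S S' u u' : unmergeable S u -> unmergeable S' u' ->
  act_addr S u = act_addr S' u' -> S = S'.
Proof.
elim: S S' u u' => [|a IHa b IHb] [|a' b'] u u' H H' e //.
- by rewrite (@affine_Leaf (Node a' b') u' (u 0)) // -e.
- by rewrite (@affine_Leaf (Node a b) u (u' 0)) // e.
have [ua ub] := unmergeable_Node H; have [ua' ub'] := unmergeable_Node H'.
rewrite (IHa a' u u') //; last first.
  by apply: funext => s; move/(congr1 (@^~ (scons false s))): e.
rewrite (IHb b' (fun i => u (leaves a + i)) (fun i => u' (leaves a' + i))) //.
by apply: funext => s; move/(congr1 (@^~ (scons true s))): e.
Qed.

Lemma reducedb_unmergeable S T : reducedb (S, T) -> unmergeable S (addr T).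
Proof.
move=> /andP[/eqP /= e /nilP c] i v iS e0 e1.
have iT : i \in xcarets T.
  by apply: addr_exposed e0 e1; rewrite /leaves -e; exact: xcarets_lt.
have : i \in common_exposed (S, T) by rewrite mem_filter; apply/andP.
by rewrite c.
Qed.

Lemma reducedbC S T : reducedb (S, T) = reducedb (T, S).
Proof.
rewrite /reducedb eq_sym; congr (_ && _).
suff H A B : nilp (common_exposed (A, B)) -> nilp (common_exposed (B, A)).
  by apply/idP/idP; exact: H.
move=> /nilP c; apply/nilP; apply: contra_eq c; rewrite -!has_filter.
by move=> /hasP[i iA iB]; apply/hasP; exists i.
Qed.

Lemma tact_inj p q : reducedb p -> reducedb q -> tact p = tact q -> p = q.
Proof.
have src A B C D : reducedb (A, B) -> reducedb (C, D) -> tact (A, B) = tact (C, D) -> A = C.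
  by move=> /reducedb_unmergeable u /reducedb_unmergeable u'; exact: unmergeable_inj.
case: p q => [A B] [C D] rp rq e; congr (_, _); first exact: src e.
have [lp lq] : leaves B = leaves A /\ leaves D = leaves C.
  by case/andP: rp => /eqP /= ep _; case/andP: rq => /eqP /= eq _; rewrite /leaves ep eq.
apply: (@src _ A _ C); rewrite ?(reducedbC _ A) ?(reducedbC _ C) //.
have DK : tact (D, C) \o tact (A, B) = id by rewrite e tact_trans ?tact_id.
have BK : tact (A, B) \o tact (B, A) = id by rewrite tact_trans ?tact_id.
transitivity ((tact (D, C) \o tact (A, B)) \o tact (B, A)); first by rewrite DK.
by rewrite -compA BK.
Qed.

(** * The group and the normal form *)

Definition stream_act (w : F) : stream -> stream := tact (sval w).

Lemma stream_act_inj : injective stream_act.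
Proof. by move=> v w e; apply: val_inj; apply: tact_inj e; apply: valP. Qed.

Lemma balanced (w : F) : carets (Tminus w) = carets (Tplus w).
Proof. by have /andP[/eqP] := valP w. Qed.

Lemma sval_mkF p : reducedb p -> sval (mkF p) = p.
Proof.
move=> rp; have H b (e : reducedb p = b) : b ->
    sval ((if b as b return reducedb p = b -> F
           then fun h => exist _ p h else fun=> Fid) e) = p by case: b e.
exact: (H _ erefl rp).
Qed.

Lemma stream_actM g h : stream_act (Fmul g h) = stream_act g \o stream_act h.
Proof.
have [c1 e1] := tcomp_spec (balanced g) (balanced h).
by have [c2 e2] := reduce_spec c1; rewrite /stream_act /Fmul sval_mkF // e2 e1.
Qed.

Lemma stream_act1 : stream_act Fid = id.
Proof. exact: tact_id. Qed.

Lemma FmulA g h k : Fmul g (Fmul h k) = Fmul (Fmul g h) k.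
Proof. by apply: stream_act_inj; rewrite !stream_actM. Qed.

Lemma Fmul1 g : Fmul g Fid = g.
Proof. by apply: stream_act_inj; rewrite stream_actM stream_act1. Qed.

Lemma Fmul1l g : Fmul Fid g = g.
Proof. by apply: stream_act_inj; rewrite stream_actM stream_act1. Qed.

Lemma gen_geninv a : Fmul (gen a) (geninv a) = Fid.
Proof.
by apply: stream_act_inj; rewrite stream_actM stream_act1; case: a;
  exact: etrans (tact_trans _ _) (tact_id _).
Qed.

Lemma geninv_gen a : Fmul (geninv a) (gen a) = Fid.
Proof.
by apply: stream_act_inj; rewrite stream_actM stream_act1; case: a;
  exact: etrans (tact_trans _ _) (tact_id _).
Qed.

Lemma FmulK h a : Fmul (Fmul h (gen a)) (geninv a) = h.
Proof. by rewrite -FmulA gen_geninv Fmul1. Qed.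

Lemma FmulVK h a : Fmul (Fmul h (geninv a)) (gen a) = h.
Proof. by rewrite -FmulA geninv_gen Fmul1. Qed.

Definition x0map : stream -> stream := stream_act (gen false).
Definition x0imap : stream -> stream := stream_act (geninv false).

Lemma x0mapE : (forall s, x0map (scons false s) = scons false (scons false s)) *
  (forall s, x0map (scons true (scons false s)) = scons false (scons true s)) *
  (forall s, x0map (scons true (scons true s)) = scons true s).
Proof. by do !split. Qed.

Lemma x0imapE : (forall s, x0imap (scons false (scons false s)) = scons false s) *
  (forall s, x0imap (scons false (scons true s)) = scons true (scons false s)) *
  (forall s, x0imap (scons true s) = scons true (scons true s)).
Proof. by do !split. Qed.

Definition up (f : stream -> stream) (s : stream) : stream :=
  if s 0 then scons true (f (stail s)) else s.

Lemma up_false f s : up f (scons false s) = scons false s.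
Proof. by []. Qed.

Lemma up_true f s : up f (scons true s) = scons true (f s).
Proof. by []. Qed.

Lemma up_comp f g : up (f \o g) = up f \o up g.
Proof. by apply: funext; elim/streamP. Qed.

Lemma up_id : up id = id.
Proof. by apply: funext; elim/streamP => s; rewrite ?up_true ?up_false. Qed.

Lemma stream_act_geninv1 : stream_act (geninv true) = up x0imap.
Proof.
by apply: funext; elim/streamP => // ; elim/streamP => //; elim/streamP.
Qed.

Lemma x0_conj_up f : x0imap \o up f \o x0map = up (up f).
Proof.
apply: funext; elim/streamP => [s|]; first by rewrite /= x0mapE up_false x0imapE.
elim/streamP => s; rewrite /= x0mapE.
  by rewrite up_false x0imapE.
by rewrite up_true x0imapE.
Qed.

Definition wval (w : word) : F := evalw_from Fid w.

Lemma evalw_fromE g w : evalw_from g w = Fmul g (wval w).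
Proof.
rewrite /wval; elim: w g => [|l w IH] g /=; first by rewrite Fmul1.
by rewrite IH [in RHS]IH FmulA Fmul1l.
Qed.

Lemma wval_cons l w : wval (l :: w) = Fmul (lval l) (wval w).
Proof. by rewrite /wval /= Fmul1l -evalw_fromE. Qed.

Lemma wval_cat u v : wval (u ++ v) = Fmul (wval u) (wval v).
Proof.
by elim: u => [|l u IH] /=; rewrite ?Fmul1l // !wval_cons IH FmulA.
Qed.

Lemma wval_freered w : wval (freered w) = wval w.
Proof.
rewrite /freered; set f := (fun st x => _).
suff H st : wval (rev (foldl f st w)) = wval (rev st ++ w) by rewrite H.
elim: w st => [|[a b] w IH] st; first by rewrite cats0.
rewrite /= IH; case: st => [//|[a' b'] st] /=.
case: ifP => [/andP[/eqP /= <- /eqP /= ->]|_]; last by rewrite !rev_cons !cat_rcons.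
rewrite rev_cons cat_rcons !wval_cat !wval_cons [Fmul (lval _) (Fmul _ _)]FmulA.
suff -> : Fmul (lval (a', ~~ b)) (lval (a', b)) = Fid by rewrite Fmul1l.
by rewrite /lval /=; case: b {IH} => /=; rewrite ?geninv_gen ?gen_geninv.
Qed.

Lemma wval_winv w : Fmul (wval (winv w)) (wval w) = Fid.
Proof.
rewrite /winv; elim: w => [|[a b] w IH]; first by rewrite Fmul1.
rewrite /= rev_cons -cats1 wval_cat !wval_cons -FmulA [Fmul (Fmul _ _) (Fmul _ _)]FmulA.
rewrite {2}/wval /= Fmul1.
suff -> : Fmul (lval (a, ~~ b)) (lval (a, b)) = Fid by rewrite Fmul1l.
by rewrite /lval /=; case: b => /=; rewrite ?geninv_gen ?gen_geninv.
Qed.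

Definition wact (w : word) : stream -> stream := stream_act (wval w).

Lemma wact_cat u v : wact (u ++ v) = wact u \o wact v.
Proof. by rewrite /wact wval_cat stream_actM. Qed.

Lemma wact_cons l w : wact (l :: w) = stream_act (lval l) \o wact w.
Proof. by rewrite /wact wval_cons stream_actM. Qed.

Lemma wact0 : wact [::] = id.
Proof. exact: stream_act1. Qed.

(* Reading a stream [1^i 0 s] as the point [s] of the [i]-th tree of an infinite forest,
   [hang t] is the map dissolving the carets of the tree [t] at position 0, and
   [dissolve t] dissolves the carets of a whole tree into a right vine. *)
Fixpoint hang (t : tree) : stream -> stream :=
  if t is Node a b then hang a \o up (hang b) \o x0imap else id.

Fixpoint dissolve (t : tree) : stream -> stream :=
  if t is Node a b then hang a \o up (dissolve b) else id.

Lemma trav_interior t : wact (trav t false false) = up (hang t).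
Proof.
elim: t => [|a IHa b IHb] /=; first by rewrite wact0 up_id.
rewrite wact_cat IHa; case: b IHb => [|b1 b2] IHb.
  by rewrite wact_cons wact0 [stream_act _]stream_act_geninv1 [hang Leaf]/= up_id up_comp.
rewrite wact_cons wact_cat IHb !wact_cons wact0 [stream_act (lval x1i)]stream_act_geninv1.
set h := hang (Node b1 b2).
rewrite (up_comp (hang a \o up h) x0imap).
by rewrite (up_comp (hang a) (up h)) -x0_conj_up.
Qed.

Lemma dissolve_rvine t : rvine t -> dissolve t = id.
Proof. by elim: t => [//|[|? ?] // _ b IHb] /= /IHb ->; rewrite up_id. Qed.

Lemma trav_rvine t : rvine t -> trav t false true = [::].
Proof. by elim: t => [//|[|? ?] // _ b IHb] /= rb; rewrite rb /= IHb. Qed.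

Lemma trav_right t : wact (trav t false true) = up (dissolve t).
Proof.
elim: t => [|a IHa b IHb]; first by rewrite wact0 up_id.
rewrite [trav _ _ _]/= wact_cat trav_interior [RHS](up_comp (hang a) (up (dissolve b))).
set r := wact (if _ then _ else _); suff -> : r = up (up (dissolve b)) by [].
rewrite {}/r.
case: ifPn => [_|]; last first.
  by rewrite negbK => rb; rewrite trav_rvine // wact0 dissolve_rvine // !up_id.
by rewrite wact_cons wact_cat IHb wact_cons wact0 -x0_conj_up.
Qed.

Lemma trav_left t :
  wact (trav t true false ++ (if t is Leaf then [::] else [:: x0i])) = hang t.
Proof.
elim: t => [|a IHa b IHb]; first by rewrite wact0.
rewrite [trav _ _ _]/= catA wact_cat wact_cat IHa trav_interior.
by rewrite wact_cons wact0.
Qed.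

Lemma wact_gamma t : wact (gamma t) = dissolve t.
Proof.
case: t => [|a b]; first exact: wact0.
by rewrite /gamma [trav _ _ _]/= catA wact_cat trav_left trav_right.
Qed.

Lemma hangE t : (forall i s, i < leaves t ->
    hang t (scons false (plug t i s)) = iter i (scons true) (scons false s)) *
  (forall s, hang t (scons true s) = iter (leaves t) (scons true) s).
Proof.
elim: t => [|a [IHa0 IHa1] b [IHb0 IHb1]]; first by split=> // -[].
split=> [i s|s]; rewrite leaves_Node.
  rewrite plug_Node; case: (ltnP i (leaves a)) => [lt_i _|le_i lt_i] /=.
    by rewrite x0imapE up_false IHa0.
  rewrite x0imapE up_true IHb0; last by lia.
  by rewrite IHa1 -iterD subnKC.
by rewrite /= x0imapE up_true IHb1 IHa1 -iterD.
Qed.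

(* The right-hand side depends on the shape of [t] only through its number of carets. *)
Lemma dissolve_plug t i s : i < leaves t -> dissolve t (plug t i s) =
  iter i (scons true) (if i == carets t then s else scons false s).
Proof.
elim: t i => [|a _ b IHb] i; first by case: i.
rewrite leaves_Node plug_Node => lt_i; case: (ltnP i (leaves a)) => [lt_ia|le_i] /=.
  by rewrite up_false hangE // ifN //; move: lt_ia; rewrite /leaves; lia.
rewrite up_true IHb; last by lia.
rewrite hangE -iterD subnKC //; congr (iter _ _ _).
by congr (if _ then _ else _); apply/eqP/eqP; move: le_i; rewrite /leaves; lia.
Qed.

Lemma evalw_eta (w : F) : evalw_from Fid (Defs.eta w) = w.
Proof.
rewrite -[LHS]/(wval (Defs.eta w)) /Defs.eta wval_freered wval_cat.
have -> : wval (gamma (Tminus w)) = Fmul (wval (gamma (Tplus w))) w.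
  apply: stream_act_inj; rewrite stream_actM -![stream_act (wval _)]/(wact _) !wact_gamma.
  apply: funext => s /=; rewrite /stream_act /tact.
  have lt1 := locate_lt (Tminus w) s; have lt2 := lt1.
  rewrite /leaves balanced in lt2.
  by rewrite -{1}(locateK (Tminus w) s) !dissolve_plug // balanced.
by rewrite FmulA wval_winv Fmul1l.
Qed.

Lemma evalw_relator g r : evalw_from g (relator r) = g.
Proof.
rewrite evalw_fromE; suff -> : wval (relator r) = Fid by exact: Fmul1.
by apply: val_inj; case: r; vm_compute.
Qed.

Import Order.TTheory GRing.Theory Num.Theory.
Import numFieldNormedType.Exports.
Local Open Scope classical_set_scope.
Local Open Scope ring_scope.

(** * Homotopies of paths *)

Section Continuity.
Context {R : realType}.

Lemma continuous_comp_all (X Y Z : topologicalType) (f : X -> Y) (g : Y -> Z) :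
  continuous f -> continuous g -> continuous (g \o f).
Proof. by move=> cf cg x; apply: continuous_comp; [exact: cf | exact: cg]. Qed.

Lemma continuous_pair (X Y Z : topologicalType) (f : X -> Y) (g : X -> Z) :
  continuous f -> continuous g -> continuous (fun x => (f x, g x)).
Proof. by move=> cf cg x; apply: cvg_pair; [exact: cf | exact: cg]. Qed.

Lemma continuous_add (X : topologicalType) (f g : X -> R) :
  continuous f -> continuous g -> continuous (fun x => f x + g x).
Proof. by move=> cf cg x; apply: continuousD; [exact: cf | exact: cg]. Qed.

Lemma continuous_opp (X : topologicalType) (f : X -> R) :
  continuous f -> continuous (fun x => - f x).
Proof. by move=> cf x; apply: continuousN; exact: cf. Qed.

Lemma continuous_mul (X : topologicalType) (f g : X -> R) :
  continuous f -> continuous g -> continuous (fun x => f x * g x).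
Proof. by move=> cf cg x; apply: continuousM; [exact: cf | exact: cg]. Qed.

Lemma continuous_minr (X : topologicalType) (f g : X -> R) :
  continuous f -> continuous g -> continuous (fun x => Num.min (f x) (g x)).
Proof. by move=> cf cg x; apply: (@continuous_min R X f g x); [exact: cf | exact: cg]. Qed.

Lemma continuous_maxr (X : topologicalType) (f g : X -> R) :
  continuous f -> continuous g -> continuous (fun x => Num.max (f x) (g x)).
Proof. by move=> cf cg x; apply: (@continuous_max R X f g x); [exact: cf | exact: cg]. Qed.

Lemma continuous_fstr (X : topologicalType) (f : X -> R * R) :
  continuous f -> continuous (fun x => (f x).1).
Proof. by move=> cf x; apply: continuous_comp; [exact: cf | exact: cvg_fst]. Qed.

Lemma continuous_sndr (X : topologicalType) (f : X -> R * R) :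
  continuous f -> continuous (fun x => (f x).2).
Proof. by move=> cf x; apply: continuous_comp; [exact: cf | exact: cvg_snd]. Qed.

Lemma continuous_fst : continuous (fun z : R * R => z.1).
Proof. by move=> z; exact: cvg_fst. Qed.

Lemma continuous_snd : continuous (fun z : R * R => z.2).
Proof. by move=> z; exact: cvg_snd. Qed.

Lemma continuous_const (X Y : topologicalType) (c : Y) : continuous (fun _ : X => c).
Proof. by move=> x; exact: cvg_cst. Qed.

Lemma continuous_idfun (X : topologicalType) : continuous (fun x : X => x).
Proof. by move=> x; exact: cvg_id. Qed.

Lemma continuous_addl (c : R) : continuous (fun x : R => c + x).
Proof.
by apply: (@continuous_add _ (fun=> c) (fun x => x));
  [exact: continuous_const | exact: continuous_idfun].
Qed.

Lemma continuous_mull (c : R) : continuous (fun x : R => c * x).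
Proof.
by apply: (@continuous_mul _ (fun=> c) (fun x => x));
  [exact: continuous_const | exact: continuous_idfun].
Qed.

Lemma continuous_oppr : continuous (fun x : R => - x).
Proof. by apply: (@continuous_opp _ (fun x => x)); exact: continuous_idfun. Qed.

Definition clamp (x : R) : R := Num.max 0 (Num.min x 1).

Lemma continuous_clamp (X : topologicalType) (f : X -> R) :
  continuous f -> continuous (fun x => clamp (f x)).
Proof.
move=> cf; apply: continuous_maxr; first exact: continuous_const.
by apply: continuous_minr => //; exact: continuous_const.
Qed.

Lemma clamp_id x : 0 <= x <= 1 -> clamp x = x.
Proof. by case/andP => x0 x1; rewrite /clamp min_l // max_r. Qed.

Lemma clamp_le0 x : x <= 0 -> clamp x = 0.
Proof. by move=> x0; rewrite /clamp min_l ?max_l //; apply: le_trans x0 _. Qed.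

Lemma clamp_ge1 x : 1 <= x -> clamp x = 1.
Proof. by move=> x1; rewrite /clamp min_r ?max_r. Qed.

Lemma clamp_itv x : 0 <= clamp x <= 1.
Proof.
have [x0|x0] := leP x 0; first by rewrite clamp_le0 // lexx ler01.
have [x1|x1] := leP 1 x; first by rewrite clamp_ge1 // lexx ler01.
by rewrite clamp_id ?(ltW x0) ?(ltW x1).
Qed.

Lemma glue_continuous (X Y : topologicalType) (a : X -> R) (f g : X -> Y) :
  continuous a -> continuous f -> continuous g ->
  (forall x, a x = 0 -> f x = g x) ->
  continuous (fun x => if a x <= 0 then f x else g x).
Proof.
move=> ca cf cg fg; set h := fun x => _.
pose A := [set x | a x <= 0]; pose B := [set x | 0 <= a x].
have cA : closed A.
  by have /continuous_closedP/(_ _ (@closed_le R 0)) := ca.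
have cB : closed B.
  by have /continuous_closedP/(_ _ (@closed_ge R 0)) := ca.
suff : {within setT, continuous h}.
  by rewrite continuous_open_subspace; [move=> ch x; apply: ch; rewrite inE | exact: openT].
have -> : [set: X] = A `|` B.
  by apply/seteqP; split=> // x _; case/orP: (le_total (a x) 0); [left|right].
apply: withinU_continuous => //.
  apply: subspace_eq_continuous (continuous_subspaceT cf) => x.
  by rewrite inE => ax; rewrite /from_subspace /h ifT.
apply: subspace_eq_continuous (continuous_subspaceT cg) => x.
rewrite inE /from_subspace /h /B /= => a0; case: ifP => // a0'; rewrite fg //.
by apply/eqP; rewrite eq_le a0 a0'.
Qed.

Lemma continuous_comp_within (X Y Z : topologicalType) (A : set Y) (f : X -> Y) (g : Y -> Z) :
  continuous f -> (forall x, A (f x)) -> {within A, continuous g} -> continuous (g \o f).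
Proof.
move=> cf fA /subspace_continuousP cg x; apply: (cvg_trans _ (cg _ (fA x))).
move=> W /= wW; have := cf x _ wW; rewrite !nbhs_filterE /=.
by apply: filterS => y; exact.
Qed.

End Continuity.

(* The point-free patterns are needed because unification eta-reduces the functions it finds. *)
Ltac cont := repeat match goal with
  | |- continuous ?f => match f with
    | fun _ => ?c => exact: continuous_const
    | fun x => x => exact: continuous_idfun
    | @fst _ _ => exact: continuous_fst
    | @snd _ _ => exact: continuous_snd
    | fun z => fst z => exact: continuous_fst
    | fun z => snd z => exact: continuous_snd
    | fun x => (_, _) => apply: continuous_pair
    | GRing.add _ => exact: continuous_addl
    | GRing.mul _ => exact: continuous_mull
    | GRing.opp => exact: continuous_oppr
    | @clamp _ => exact: (continuous_clamp (@continuous_idfun _))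
    | fun x => clamp _ => apply: continuous_clamp
    | fun x => Num.min _ _ => apply: continuous_minr
    | fun x => Num.max _ _ => apply: continuous_maxr
    | fun x => _ + _ => apply: continuous_add
    | fun x => _ * _ => apply: continuous_mul
    | fun x => - _ => apply: continuous_opp
    end
  end.

Section Homotopy.
Context {R : realType} {T : topologicalType}.
Implicit Types (p q r : R -> T) (H : R * R -> T).

Definition path_between x y p : Prop :=
  [/\ continuous (p \o clamp), p 0 = x & p 1 = y].

Definition homotopic p q : Prop :=
  exists H, [/\ continuous H,
    (forall s, 0 <= s <= 1 -> H (s, 0) = p s),
    (forall s, 0 <= s <= 1 -> H (s, 1) = q s) &
    (forall t, 0 <= t <= 1 -> H (0, t) = p 0 /\ H (1, t) = p 1)].

Lemma homotopic_eq p p' q q' :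
  (forall s, 0 <= s <= 1 -> p s = p' s) -> (forall s, 0 <= s <= 1 -> q s = q' s) ->
  homotopic p q -> homotopic p' q'.
Proof.
move=> pp qq [H [cH H0 H1 He]]; exists H; split=> //.
- by move=> s sI; rewrite H0 // pp.
- by move=> s sI; rewrite H1 // qq.
- by move=> t tI; rewrite -!pp ?lexx ?ler01 //; exact: He.
Qed.

(* The square is convex, so a straight-line homotopy deforms [phi] to [psi] inside it. *)
Lemma homotopic_square H (phi psi : R -> R * R) :
  continuous H -> continuous phi -> continuous psi -> phi 0 = psi 0 -> phi 1 = psi 1 ->
  homotopic (H \o phi) (H \o psi).
Proof.
move=> cH cphi cpsi e0 e1.
have line (u v : R * R) (t : R) : u = v ->
    ((1 - t) * u.1 + t * v.1, (1 - t) * u.2 + t * v.2) = u.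
  by move=> <-; case: u => a b /=; congr (_, _); ring.
pose G (z : R * R) : R * R := ((1 - z.2) * (phi z.1).1 + z.2 * (psi z.1).1,
                       (1 - z.2) * (phi z.1).2 + z.2 * (psi z.1).2).
have cz : continuous (fun z : R * R => z.1) by cont.
have cG : continuous G.
  have c1 := continuous_comp_all cz cphi; have c2 := continuous_comp_all cz cpsi.
  by rewrite /G; cont; do ?[exact: (continuous_fstr c1) | exact: (continuous_fstr c2)
    | exact: (continuous_sndr c1) | exact: (continuous_sndr c2)].
exists (H \o G); split.
- exact: continuous_comp_all cG cH.
- move=> s _; rewrite /G /= subr0 !mul1r !mul0r !addr0; by case: (phi s).
- move=> s _; rewrite /G /= subrr !mul1r !mul0r !add0r; by case: (psi s).
- by move=> t _; rewrite /G /= !line.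
Qed.

Lemma homotopic_reparam x y p (phi psi : R -> R) : path_between x y p ->
  continuous phi -> continuous psi -> phi 0 = psi 0 -> phi 1 = psi 1 ->
  (forall s, 0 <= s <= 1 -> 0 <= phi s <= 1) ->
  (forall s, 0 <= s <= 1 -> 0 <= psi s <= 1) ->
  homotopic (p \o phi) (p \o psi).
Proof.
case=> cp _ _ cphi cpsi e0 e1 phiI psiI.
pose K (z : R * R) := (p \o clamp) z.1.
have : homotopic (K \o (fun s : R => (phi s, 0 : R))) (K \o (fun s : R => (psi s, 0 : R))).
  apply: homotopic_square; [|by cont|by cont| |]; rewrite ?e0 ?e1 //.
  by rewrite /K; apply: continuous_comp_all cp; cont.
by apply: homotopic_eq => s; [move/phiI | move/psiI] => sI; rewrite /K /= clamp_id.
Qed.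

Lemma homotopic_refl x y p : path_between x y p -> homotopic p p.
Proof.
by move=> pp; apply: (homotopic_reparam (phi := id) (psi := id) pp) => //;
  exact: continuous_idfun.
Qed.

Lemma homotopic_sym p q : homotopic p q -> homotopic q p.
Proof.
case=> H [cH H0 H1 He]; have I1 : 0 <= (1 : R) <= 1 by rewrite lexx ler01.
have I0 : 0 <= (0 : R) <= 1 by rewrite lexx ler01.
exists (H \o (fun z : R * R => (z.1, 1 - z.2))); split => /=.
- by apply: continuous_comp_all cH; cont.
- by move=> s sI; rewrite subr0 H1.
- by move=> s sI; rewrite subrr H0.
- move=> t tI; rewrite -!H1 // !(proj1 (He _ _)) ?(proj2 (He _ _)) //; lra.
Qed.

Lemma homotopic_trans p q r : homotopic p q -> homotopic q r -> homotopic p r.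
Proof.
case=> H [cH H0 H1 He] [K [cK K0 K1 Ke]].
have I1 : 0 <= (1 : R) <= 1 by rewrite lexx ler01.
have I0 : 0 <= (0 : R) <= 1 by rewrite lexx ler01.
have [q0 q1] : q 0 = p 0 /\ q 1 = p 1 by rewrite -!H1 //; apply: He.
exists (fun z : R * R => if z.2 - 2^-1 <= 0 then H (clamp z.1, 2 * z.2)
                 else K (clamp z.1, 2 * z.2 - 1)); split.
- apply: (@glue_continuous _ _ _ (fun z : R * R => z.2 - 2^-1)); first by cont.
  + by apply: (@continuous_comp_all _ _ _ (fun z : R * R => (clamp z.1, 2 * z.2))) cH; cont.
  + by apply: (@continuous_comp_all _ _ _ (fun z : R * R => (clamp z.1, 2 * z.2 - 1))) cK; cont.
  + move=> z z2; have -> : z.2 = 2^-1 by lra.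
    rewrite divff ?pnatr_eq0 // subrr H1 ?K0 //; exact: clamp_itv.
- move=> s sI /=; rewrite sub0r mulr0 clamp_id // ifT; last by lra.
  exact: H0.
- move=> s sI /=; rewrite clamp_id // ifF; last by apply/negbTE; lra.
  have -> : 2 * 1 - 1 = 1 :> R by lra.
  exact: K1.
- move=> t tI /=; rewrite !(clamp_id I0) !(clamp_id I1); case: ifP => th.
    by apply: He; lra.
  by rewrite -q0 -q1; apply: Ke; move/negbT: th; rewrite -ltNge => th; lra.
Qed.

Lemma pconcatl p q s : s <= 2^-1 -> pconcat p q s = p (2 * s).
Proof. by rewrite /pconcat => ->. Qed.

Lemma pconcatr p q s : 2^-1 < s -> pconcat p q s = q (2 * s - 1).
Proof. by rewrite /pconcat ltNge => /negbTE ->. Qed.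

Lemma pconcat0 p q : pconcat p q 0 = p 0.
Proof. by rewrite pconcatl ?mulr0 ?invr_ge0 ?ler0n. Qed.

Lemma pconcat1 p q : pconcat p q 1 = q 1.
Proof. by rewrite pconcatr; [congr q; lra | lra]. Qed.

Lemma path_between_concat x y z p q : path_between x y p -> path_between y z q ->
  path_between x z (pconcat p q).
Proof.
case=> cp p0 p1 [cq q0 q1]; split; last first.
- by rewrite pconcat1.
- by rewrite pconcat0.
have -> : pconcat p q \o clamp = fun s => if clamp s - 2^-1 <= 0
    then (p \o clamp) (2 * clamp s) else (q \o clamp) (2 * clamp s - 1).
  apply: funext => s; rewrite /pconcat /= subr_le0; have sI := clamp_itv s.
  by case: leP => h; [congr p | congr q]; symmetry; apply: clamp_id; lra.
apply: (@glue_continuous _ _ _ (fun s : R => clamp s - 2^-1)); first by cont.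
- by apply: (@continuous_comp_all _ _ _ (fun s : R => 2 * clamp s)) cp; cont.
- by apply: (@continuous_comp_all _ _ _ (fun s : R => 2 * clamp s - 1)) cq; cont.
- move=> s s2; have -> : clamp s = 2^-1 by lra.
  by rewrite divff ?pnatr_eq0 // subrr /= (clamp_ge1 (lexx _)) (clamp_le0 (lexx _)) p1 q0.
Qed.

Lemma path_between_rev x y p : path_between x y p -> path_between y x (preverse p).
Proof.
case=> cp p0 p1; rewrite /preverse; split; rewrite ?subr0 ?subrr //.
have -> : (fun s => p (1 - s)) \o clamp = (p \o clamp) \o (fun s => 1 - clamp s).
  by apply: funext => s /=; rewrite [RHS](congr1 p (clamp_id _)) //; have := clamp_itv s; lra.
by apply: continuous_comp_all cp; cont.
Qed.

Lemma path_between_const x : path_between x x (fun=> x).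
Proof. by split=> //; exact: continuous_const. Qed.

Lemma homotopic_concat x y z p p' q q' :
  path_between x y p -> path_between y z q ->
  homotopic p p' -> homotopic q q' -> homotopic (pconcat p q) (pconcat p' q').
Proof.
case=> _ p0 p1 [_ q0 q1] [H [cH H0 H1 He]] [K [cK K0 K1 Ke]].
exists (fun z : R * R => if z.1 - 2^-1 <= 0 then H (2 * z.1, clamp z.2)
                 else K (2 * z.1 - 1, clamp z.2)); split.
- apply: (@glue_continuous _ _ _ (fun z : R * R => z.1 - 2^-1)); first by cont.
  + by apply: (@continuous_comp_all _ _ _ (fun z : R * R => (2 * z.1, clamp z.2))) cH; cont.
  + by apply: (@continuous_comp_all _ _ _ (fun z : R * R => (2 * z.1 - 1, clamp z.2))) cK; cont.
  + move=> w w2; have -> : w.1 = 2^-1 by lra.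
    rewrite divff ?pnatr_eq0 // subrr (proj2 (He _ (clamp_itv _))).
    by rewrite (proj1 (Ke _ (clamp_itv _))) p1 q0.
- move=> s sI /=; rewrite /pconcat subr_le0 (clamp_le0 (lexx _)).
  by case: leP => h; [apply: H0 | apply: K0]; lra.
- move=> s sI /=; rewrite /pconcat subr_le0 (clamp_ge1 (lexx _)).
  by case: leP => h; [apply: H1 | apply: K1]; lra.
- move=> t tI /=; rewrite pconcat0 pconcat1 (clamp_id tI) ifT ?mulr0; last by lra.
  rewrite ifF; last by apply/negbTE; lra.
  have -> : 2 * 1 - 1 = 1 :> R by lra.
  by rewrite (proj1 (He _ tI)) (proj2 (Ke _ tI)).
Qed.

Lemma concat_assoc x y z w p q r :
  path_between x y p -> path_between y z q -> path_between z w r ->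
  homotopic (pconcat (pconcat p q) r) (pconcat p (pconcat q r)).
Proof.
move=> pp pq pr; have pc := path_between_concat pp (path_between_concat pq pr).
pose phi (s : R) := Num.min (2 * s) (Num.min (s + 4^-1) ((1 + s) / 2)).
have phiE s : [\/ s <= 4^-1 /\ phi s = 2 * s, 4^-1 <= s <= 2^-1 /\ phi s = s + 4^-1 |
    2^-1 <= s /\ phi s = (1 + s) / 2].
  rewrite /phi; case: (leP (s + 4^-1) ((1 + s) / 2)) => h1.
    case: (leP (2 * s) (s + 4^-1)) => h2; [constructor 1|constructor 2]; split=> //; lra.
  case: (leP (2 * s) ((1 + s) / 2)) => h2; [constructor 1|constructor 3]; split=> //; lra.
apply: (homotopic_eq _ _ (homotopic_reparam (phi := phi) (psi := id) pc _ _ _ _ _ _)) => //.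
- move=> s sI /=; case: (phiE s) => -[h ->].
  + rewrite [LHS]pconcatl; last by lra.
    rewrite [RHS]pconcatl; last by lra.
    by rewrite pconcatl; [ | lra].
  + rewrite [RHS]pconcatl; last by lra.
    have [s4|s4] := leP s 4^-1.
      rewrite [LHS]pconcatl; last by lra.
      by rewrite pconcatl; [congr p; lra | lra].
    rewrite [LHS]pconcatr; last by lra.
    rewrite [LHS]pconcatl; last by lra.
    by rewrite pconcatr; [congr q; lra | lra].
  + have [s2|s2] := leP s 2^-1.
      have -> : s = 2^-1 by lra.
      rewrite [RHS]pconcatl; last by lra.
      rewrite [LHS]pconcatr; last by lra.
      rewrite [LHS]pconcatl; last by lra.
      by rewrite pconcatr; [congr q; lra | lra].
    rewrite [LHS]pconcatr; last by lra.
    rewrite [LHS]pconcatr; last by lra.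
    by rewrite pconcatr; [congr r; lra | lra].
- by rewrite /phi; cont.
- exact: continuous_idfun.
- by case: (phiE 0) => -[h ->]; lra.
- by case: (phiE 1) => -[h ->]; lra.
- by move=> s sI; case: (phiE s) => -[h ->]; lra.
Qed.

Lemma concat_revr x y p : path_between x y p ->
  homotopic (pconcat p (preverse p)) (fun=> x).
Proof.
move=> pp; have [_ p0 p1] := pp.
apply: (homotopic_eq _ _ (homotopic_reparam (phi := fun s => Num.min (2 * s) (2 - 2 * s))
  (psi := fun=> 0) pp _ _ _ _ _ _)).
- move=> s sI /=; have [h|h] := leP s 2^-1; first by rewrite min_l ?pconcatl //; lra.
  rewrite [RHS]pconcatr // min_r; last by lra.
  by rewrite /preverse; congr p; lra.
- by move=> s _ /=.
- by cont.
- by cont.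
- by rewrite min_l; lra.
- by rewrite min_r; lra.
- by move=> s sI; case: (leP (2 * s) (2 - 2 * s)) => h; lra.
- by move=> s _; rewrite lexx ler01.
Qed.

Lemma concat_constr x y p : path_between x y p -> homotopic (pconcat p (fun=> y)) p.
Proof.
move=> pp; have [_ p0 p1] := pp.
apply: (homotopic_eq _ _ (homotopic_reparam (phi := fun s => Num.min (2 * s) 1)
  (psi := id) pp _ _ _ _ _ _)) => //.
- move=> s sI /=; have [h|h] := leP s 2^-1; first by rewrite min_l ?pconcatl //; lra.
  by rewrite min_r ?pconcatr //; lra.
- by cont.
- exact: continuous_idfun.
- by rewrite min_l; lra.
- by rewrite min_r; lra.
- by move=> s sI; case: (leP (2 * s) 1) => h; lra.
Qed.

Lemma concat_constl x y p : path_between x y p -> homotopic (pconcat (fun=> x) p) p.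
Proof.
move=> pp; have [_ p0 p1] := pp.
apply: (homotopic_eq _ _ (homotopic_reparam (phi := fun s => Num.max 0 (2 * s - 1))
  (psi := id) pp _ _ _ _ _ _)) => //.
- move=> s sI /=; have [h|h] := leP s 2^-1; first by rewrite max_l ?pconcatl //; lra.
  by rewrite max_r ?pconcatr //; lra.
- by cont.
- exact: continuous_idfun.
- by rewrite max_l; lra.
- by rewrite max_r; lra.
- by move=> s sI; case: (leP 0 (2 * s - 1)) => h; lra.
Qed.

Lemma concat_revl x y p : path_between x y p ->
  homotopic (pconcat (preverse p) p) (fun=> y).
Proof.
move=> /path_between_rev /concat_revr; apply: homotopic_eq => // s _.
by rewrite /pconcat /preverse; case: ifP => // _; rewrite subKr.
Qed.

Lemma concat_eq_of_loop x y z p e q :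
  path_between x y p -> path_between y z e -> path_between x z q ->
  homotopic (pconcat p (pconcat e (preverse q))) (fun=> x) -> homotopic (pconcat p e) q.
Proof.
move=> pp pe pq h; have pr := path_between_rev pq.
have ppe := path_between_concat pp pe.
apply: homotopic_trans (homotopic_sym (concat_constr ppe)) _.
apply: homotopic_trans (homotopic_concat ppe (path_between_const z) (homotopic_refl ppe)
  (homotopic_sym (concat_revl pq))) _.
apply: homotopic_trans (homotopic_sym (concat_assoc ppe pr pq)) _.
apply: homotopic_trans (concat_constl pq).
apply: (homotopic_concat (path_between_concat ppe pr) pq) (homotopic_refl pq).
exact: homotopic_trans (concat_assoc pp pe pr) h.
Qed.

Lemma loop_of_concat_eq x y z p e q :
  path_between x y p -> path_between y z e -> path_between x z q ->
  homotopic (pconcat p e) q -> homotopic (pconcat p (pconcat e (preverse q))) (fun=> x).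
Proof.
move=> pp pe pq h; have pr := path_between_rev pq.
have ppe := path_between_concat pp pe.
apply: homotopic_trans (homotopic_sym (concat_assoc pp pe pr)) _.
apply: homotopic_trans (concat_revr pq).
exact: homotopic_concat ppe pr h (homotopic_refl pr).
Qed.

Lemma concat_eq_rev x y z p e q :
  path_between x y p -> path_between y z e -> path_between x z q ->
  homotopic (pconcat p e) q -> homotopic (pconcat q (preverse e)) p.
Proof.
move=> pp pe pq h; have pr := path_between_rev pe.
apply: homotopic_trans (homotopic_concat pq pr (homotopic_sym h) (homotopic_refl pr)) _.
apply: homotopic_trans (concat_assoc pp pe pr) _.
apply: homotopic_trans (concat_constr pp).
exact: homotopic_concat pp (path_between_concat pe pr) (homotopic_refl pp) (concat_revr pe).
Qed.

Lemma concat_cancelr x y z p q r :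
  path_between x y p -> path_between x y q -> path_between y z r ->
  homotopic (pconcat p r) (pconcat q r) -> homotopic p q.
Proof.
move=> pp pq pr h; apply: homotopic_sym.
apply: homotopic_trans (concat_eq_rev pp pr (path_between_concat pp pr) _).
  exact: homotopic_sym (concat_eq_rev pq pr (path_between_concat pp pr) (homotopic_sym h)).
exact: homotopic_refl (path_between_concat pp pr).
Qed.

(* In the fundamental groupoid, [q e b = p a e b = p = r b]. *)
Lemma concat_eq_of_trivial_loop x v y z p q r a e b :
  path_between x v p -> path_between v y a -> path_between y z e -> path_between z v b ->
  path_between x y q -> path_between x z r ->
  homotopic (pconcat a (pconcat e b)) (fun=> v) ->
  homotopic (pconcat p a) q -> homotopic (pconcat r b) p ->
  homotopic (pconcat q e) r.
Proof.
move=> pp pa pe pb pq pr h hq hr.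
have peb := path_between_concat pe pb; have pqe := path_between_concat pq pe.
apply: (concat_cancelr pqe pr pb); apply: homotopic_trans (homotopic_sym hr).
apply: homotopic_trans (concat_assoc pq pe pb) _.
apply: homotopic_trans (homotopic_concat pq peb (homotopic_sym hq) (homotopic_refl peb)) _.
apply: homotopic_trans (concat_assoc pp pa peb) _.
apply: homotopic_trans (concat_constr pp).
exact: homotopic_concat pp (path_between_concat pa peb) (homotopic_refl pp) h.
Qed.

(* The bottom side of the square deforms to the path along its three other sides, which runs
   along [H (0, _)], stays at [x] and runs back. *)
Lemma homotopic_const_of_free H x : continuous H ->
  (forall s, 0 <= s <= 1 -> H (s, 1) = x) ->
  (forall t, 0 <= t <= 1 -> H (0, t) = H (1, t)) ->
  homotopic (fun s => H (s, 0)) (fun=> H (0, 0)).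
Proof.
move=> cH H1 He.
pose d (t : R) := H (0, clamp t).
have pd : path_between (H (0, 0)) x d.
  split; rewrite /d /= ?(clamp_le0 (lexx _)) ?(clamp_ge1 (lexx _)) ?H1 ?lexx ?ler01 //.
  by apply: (@continuous_comp_all _ _ _ (fun t : R => (0, clamp (clamp t)))) cH; cont.
pose tau (s : R) := clamp (4 * Num.min s (1 - s)).
have tauE s : 0 <= s <= 1 -> H (clamp (2 * s - 2^-1), tau s) = d (tau s).
  move=> sI; rewrite /d /tau [clamp (clamp _)]clamp_id ?clamp_itv //.
  have [s1|s1] := leP s (4^-1); first by rewrite (clamp_le0 (x := 2 * s - _)) //; lra.
  have [s2|s2] := leP (3 / 4) s.
    rewrite (clamp_ge1 (x := 2 * s - _)); last by lra.
    by rewrite -He ?clamp_itv.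
  rewrite (clamp_ge1 (x := 4 * _)); last by case: (leP s (1 - s)) => h; lra.
  by rewrite !H1 // ?lexx ?ler01 // clamp_itv.
have min0 : Num.min (0 : R) (1 - 0) = 0 by rewrite min_l //; lra.
have min1 : Num.min (1 : R) (1 - 1) = 0 by rewrite min_r ?subrr //; lra.
apply: (@homotopic_trans _ (d \o tau)); last first.
  apply: (homotopic_eq _ _ (homotopic_reparam (phi := tau) (psi := fun=> 0)
    pd _ _ _ _ _ _)) => //.
  - by move=> s _; rewrite /d /= clamp_le0.
  - by rewrite /tau; cont.
  - by cont.
  - by rewrite /tau min0 mulr0 clamp_le0.
  - by rewrite /tau min1 mulr0 clamp_le0.
  - by move=> s _; exact: clamp_itv.
  - by move=> s _; rewrite lexx ler01.
apply: (homotopic_eq _ _ (homotopic_square (phi := fun s => (s, 0))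
  (psi := fun s => (clamp (2 * s - 2^-1), tau s)) cH _ _ _ _)) => //.
- by cont.
- by rewrite /tau; cont.
- by rewrite /tau min0 mulr0 !clamp_le0 //; lra.
- by rewrite /tau min1 mulr0 (clamp_le0 (lexx 0)) clamp_ge1 //; lra.
Qed.

(* [(sigma, tau)] maps the boundary of the square to itself: the left, top and right sides go
   to the parts of the bottom side parametrising [p], [e] and [q], and the bottom side goes to
   the three other sides, where the null-homotopy is constant. *)
Lemma square_of_trivial_loop x y z p e q :
  path_between x y p -> path_between y z e -> path_between x z q ->
  homotopic (pconcat p (pconcat e (preverse q))) (fun=> x) ->
  exists H, [/\ continuous H,
    (forall s, 0 <= s <= 1 -> H (s, 0) = x),
    (forall s, 0 <= s <= 1 -> H (s, 1) = e s) &
    (forall t, 0 <= t <= 1 -> H (0, t) = p t /\ H (1, t) = q t)].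
Proof.
case=> _ p0 p1 [_ e0 e1] [_ q0 q1] [H [cH H0 H1 He]].
have lp0 : pconcat p (pconcat e (preverse q)) 0 = x.
  by rewrite pconcat0.
have lp1 : pconcat p (pconcat e (preverse q)) 1 = x.
  by rewrite !pconcat1 /preverse subrr.
pose sigma (z : R * R) := (1 - z.2) * clamp (2 * z.1 - 2^-1) + z.2 * (2^-1 + z.1 / 4).
pose tau (z : R * R) := 4 * Num.min z.1 (1 - z.1) * (1 - z.2).
exists (fun z : R * R => H (clamp (sigma z), clamp (tau z))); split.
- by apply: (@continuous_comp_all _ _ _ (fun z : R * R => (clamp (sigma z), clamp (tau z)))) cH;
    rewrite /sigma /tau; cont.
- move=> s sI; rewrite /sigma /tau /= subr0 mulr1 mul1r mul0r addr0.
  rewrite (clamp_id (clamp_itv _)).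
  have [s1|s1] := leP s (4^-1).
    rewrite (clamp_le0 (x := 2 * s - _)); last by lra.
    by rewrite (proj1 (He _ (clamp_itv _))) lp0.
  have [s2|s2] := leP (3 / 4) s.
    rewrite (clamp_ge1 (x := 2 * s - _)); last by lra.
    by rewrite (proj2 (He _ (clamp_itv _))) lp1.
  rewrite (clamp_ge1 (x := 4 * _)); last by case: (leP s (1 - s)) => h; lra.
  by rewrite H1 // clamp_itv.
- move=> s sI; rewrite /sigma /tau /= subrr mulr0 mul0r mul1r add0r.
  rewrite (clamp_le0 (lexx _)) clamp_id; last by lra.
  rewrite H0; last by lra.
  have [h|h] := leP (2^-1 + s / 4) 2^-1.
    have -> : s = 0 by lra.
    by rewrite pconcatl; [rewrite e0 -p1; congr p; lra | lra].
  by rewrite pconcatr // pconcatl; [congr e; lra | lra].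
- move=> t tI; rewrite /sigma /tau /= (clamp_le0 (x := 2 * 0 - _)); last by lra.
  rewrite (clamp_ge1 (x := 2 * 1 - _)); last by lra.
  rewrite min_l; last by lra.
  rewrite min_r; last by lra.
  have -> : clamp (4 * 0 * (1 - t)) = 0 by rewrite clamp_id; lra.
  have -> : clamp (4 * (1 - 1) * (1 - t)) = 0 by rewrite clamp_id; lra.
  have -> : clamp ((1 - t) * 0 + t * (2^-1 + 0 / 4)) = t / 2 by rewrite clamp_id; lra.
  have -> : clamp ((1 - t) * 1 + t * (2^-1 + 1 / 4)) = 1 - t / 4 by rewrite clamp_id; lra.
  rewrite [H (t / 2, 0)]H0; last by lra.
  rewrite H0; last by lra.
  split; first by rewrite pconcatl; [congr p; lra | lra].
  rewrite pconcatr; last by lra.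
  case: (eqVneq t 1) => [->|t1].
    by rewrite pconcatl; [rewrite q1 -e1; congr e; lra | lra].
  have lt_t : t < 1 by rewrite lt_neqAle t1; case/andP: tI.
  by rewrite pconcatr; [rewrite /preverse; congr q; lra | lra].
Qed.

End Homotopy.

(** * Paths in the Cayley complex *)

Lemma path_between_map (R : realType) (T U : topologicalType) (f : T -> U) x y (p : R -> T) :
  continuous f -> path_between x y p -> path_between (f x) (f y) (f \o p).
Proof.
move=> cf [cp p0 p1]; split; rewrite /= ?p0 ?p1 //.
exact: continuous_comp_all cp cf.
Qed.

Lemma homotopic_map (R : realType) (T U : topologicalType) (f : T -> U) (p q : R -> T) :
  continuous f -> homotopic p q -> homotopic (f \o p) (f \o q).
Proof.
move=> cf [H [cH H0 H1 He]]; exists (f \o H); split=> /=.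
- exact: continuous_comp_all cH cf.
- by move=> s sI; rewrite H0.
- by move=> s sI; rewrite H1.
- by move=> t tI; have [-> ->] := He t tI.
Qed.

Lemma pconcat_map (R : realType) (T U : Type) (f : T -> U) (p q : R -> T) :
  f \o pconcat p q = pconcat (f \o p) (f \o q).
Proof. by apply: funext => s; rewrite /pconcat /=; case: ifP. Qed.

Lemma homotopic_null_homotopic (R : realType) (T : topologicalType) (p : R -> T) x :
  null_homotopic p x -> homotopic p (fun=> x).
Proof.
case=> H [cH H0 H1 He]; have I0 : 0 <= (0 : R) <= 1 by rewrite lexx ler01.
have I1 : 0 <= (1 : R) <= 1 by rewrite lexx ler01.
exists (H \o (fun z : R * R => (clamp z.1, clamp z.2))); split=> /=.
- apply: (continuous_comp_within (A := sq01)) cH; first by cont.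
  by move=> z; split; exact: clamp_itv.
- by move=> s sI; rewrite !clamp_id // H0.
- by move=> s sI; rewrite !clamp_id // H1.
- move=> t tI; rewrite !clamp_id //; have [-> ->] := He t tI.
  by rewrite -!H0 // (proj1 (He 0 I0)) (proj2 (He 0 I0)).
Qed.

Section Paths.
Context {R : realType}.
Implicit Types (g h w : F) (a : bool) (l : letter) (u v : word) (s t : R).

Lemma continuous_epoint g a : continuous (@epoint R g a \o clamp).
Proof.
apply: (continuous_comp_within (A := I01)); first by cont.
  by move=> s; exact: clamp_itv.
by apply/continuousP => U oU; exact: oU.
Qed.

Lemma epoint0 g a : @epoint R g a 0 = V g.
Proof. by rewrite /epoint insubF ?ltxx //= lexx. Qed.

Lemma epoint1 g a : @epoint R g a 1 = V (Fmul g (gen a)).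
Proof. by rewrite /epoint insubF ?ltxx ?andbF //= ler10. Qed.

Lemma epoint_path g a : path_between (V g) (V (Fmul g (gen a))) (@epoint R g a).
Proof. by split; [exact: continuous_epoint | exact: epoint0 | exact: epoint1]. Qed.

Lemma lpoint_path g l : path_between (V g) (V (Fmul g (lval l))) (@lpoint R g l).
Proof.
case: l => a [] /=; first exact: epoint_path.
rewrite /lpoint /lval /=; have := path_between_rev (epoint_path (Fmul g (geninv a)) a).
by rewrite FmulVK.
Qed.

Lemma lpoint_rev g a : @lpoint R (Fmul g (gen a)) (a, false) = preverse (lpoint g (a, true)).
Proof. by apply: funext => s; rewrite /lpoint /preverse /= FmulK. Qed.

Lemma wpath_nil g : @wpath R g [::] = fun=> V g.
Proof. by []. Qed.

Lemma wpath_seq1 g l : @wpath R g [:: l] = lpoint g l.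
Proof.
by apply: funext => s; rewrite /wpath /= minn0 /= mulr1 subr0.
Qed.

Definition split_time (n : nat) s : R :=
  Num.min (s * n.+1%:R / 2) (2^-1 + (s * n.+1%:R - 1) / n%:R / 2).

Lemma split_timeP n s : (0 < n)%N -> 0 <= s <= 1 ->
  [/\ s * n.+1%:R <= 1 -> split_time n s = s * n.+1%:R / 2,
      1 <= s * n.+1%:R -> split_time n s = 2^-1 + (s * n.+1%:R - 1) / n%:R / 2 &
      0 <= split_time n s <= 1].
Proof.
move=> n0 sI; rewrite /split_time -natr1; set m : R := n%:R; set y := s * (m + 1).
have m1 : 1 <= m by rewrite ler1n.
have mV : m * m^-1 = 1 by rewrite divff // gt_eqF // (lt_le_trans ltr01).
have i0 : 0 < m^-1 by rewrite invr_gt0 (lt_le_trans ltr01).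
set i := m^-1 in mV i0 *.
have i1 : i <= 1 by nra.
have y0 : 0 <= y by rewrite /y; nra.
have ym : y <= m + 1 by rewrite /y; nra.
have [y1|y1] := leP y 1.
  have h : y / 2 <= 2^-1 + (y - 1) * i / 2 by nra.
  rewrite min_l //; split=> //; last by lra.
  move=> y1'; have -> : y = 1 by lra.
  by rewrite subrr !mul0r addr0 mul1r.
have h : 2^-1 + (y - 1) * i / 2 <= y / 2 by nra.
by rewrite min_r //; split=> //; nra.
Qed.

Lemma continuous_split_time n : continuous (split_time n).
Proof. by rewrite /split_time; cont. Qed.

Lemma wpath_nonnil g v t : (0 < size v)%N -> @wpath R g v t =
  let k := minn (Num.truncn (t * (size v)%:R)) (size v).-1 in
  lpoint (evalw_from g (take k v)) (nth x0 v k) (t * (size v)%:R - k%:R).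
Proof. by case: v. Qed.

Lemma wpath_cons g l v s : (0 < size v)%N -> 0 <= s <= 1 ->
  @wpath R g (l :: v) s =
  pconcat (lpoint g l) (wpath (Fmul g (lval l)) v) (split_time (size v) s).
Proof.
move=> n0 sI; rewrite wpath_nonnil //=; set n := size v in n0 *.
have [e1 e2 /andP[p0 p1]] := split_timeP n0 sI; set y := s * n.+1%:R in e1 e2 *.
have y0 : 0 <= y by rewrite /y mulr_ge0 ?ler0n //; case/andP: sI.
have [y1|y1] := ltP y 1.
  have -> : Num.truncn y = 0%N by apply: truncn_def; rewrite y0 y1.
  rewrite (e1 (ltW y1)) min0n /= subr0.
  by rewrite pconcatl; [congr lpoint; lra | lra].
have m0 : 0 < n%:R :> R by rewrite ltr0n.
set m := Num.truncn (y - 1).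
have /andP[m1 m2] : m%:R <= y - 1 < m.+1%:R by apply: truncn_itv; lra.
have -> : Num.truncn y = m.+1.
  by apply: truncn_def; rewrite -!natr1 in m2 *; lra.
have -> : minn m.+1 n = (minn m n.-1).+1 by lia.
rewrite /= e2 //; case: (eqVneq y 1) => [y1'|y1'].
  have m00 : m = 0%N by rewrite /m y1' subrr truncn0.
  rewrite y1' subrr mul0r mul0r addr0 m00 min0n /= take0 subrr.
  rewrite pconcatl // divff ?pnatr_eq0 //.
  by have [_ -> _] := lpoint_path (Fmul g (lval l)) (nth x0 v 0);
    have [_ _ ->] := lpoint_path g l.
have lt1y : 1 < y by rewrite lt_neqAle eq_sym y1'.
rewrite pconcatr; last first.
  by rewrite ltrDl divr_gt0 // divr_gt0 // subr_gt0.
rewrite wpath_nonnil // -/n.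
have -> : (2 * (2^-1 + (y - 1) / n%:R / 2) - 1) * n%:R = y - 1.
  by field; rewrite pnatr_eq0 -lt0n.
by rewrite -/m /=; congr lpoint; rewrite -natr1; ring.
Qed.

Lemma split_time0 n : (0 < n)%N -> split_time n 0 = 0.
Proof.
move=> n0; have I0 : 0 <= (0 : R) <= 1 by rewrite lexx ler01.
by have [e _ _] := split_timeP n0 I0; rewrite e ?mul0r ?ler01.
Qed.

Lemma split_time1 n : (0 < n)%N -> split_time n 1 = 1.
Proof.
move=> n0; have I1 : 0 <= (1 : R) <= 1 by rewrite lexx ler01.
have [_ e _] := split_timeP n0 I1; rewrite e mul1r ?ler1n //.
by rewrite -(natr1 n) addrK divff ?pnatr_eq0 -?lt0n //; lra.
Qed.

Lemma wpath_path g v : path_between (V g) (V (evalw_from g v)) (@wpath R g v).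
Proof.
elim: v g => [|l [|l' v] IH] g; first exact: path_between_const.
  by rewrite wpath_seq1; exact: lpoint_path.
have n0 : (0 < size (l' :: v))%N by [].
have [cc c0 c1] := path_between_concat (lpoint_path g l) (IH (Fmul g (lval l))).
split.
- have -> : wpath g [:: l, l' & v] \o clamp =
      (pconcat (lpoint g l) (wpath (Fmul g (lval l)) (l' :: v)) \o clamp) \o
      (split_time (size (l' :: v)) \o clamp).
    apply: funext => s /=; have sI := clamp_itv s.
    rewrite wpath_cons // [clamp (split_time _ _)]clamp_id //.
    by have [] := split_timeP n0 sI.
  apply: continuous_comp_all cc; apply: continuous_comp_all; first by cont.
  exact: continuous_split_time.
- by rewrite wpath_cons ?lexx ?ler01 // split_time0.
- by rewrite wpath_cons ?lexx ?ler01 // split_time1.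
Qed.

Lemma homotopic_wpath_cons g l v : homotopic (@wpath R g (l :: v))
  (pconcat (lpoint g l) (wpath (Fmul g (lval l)) v)).
Proof.
case: v => [|l' v].
  by rewrite wpath_seq1 wpath_nil; exact: homotopic_sym (concat_constr (lpoint_path g l)).
have n0 : (0 < size (l' :: v))%N by [].
apply: (homotopic_eq _ _ (homotopic_reparam (phi := split_time (size (l' :: v))) (psi := id)
  (path_between_concat (lpoint_path g l) (wpath_path _ _)) _ _ _ _ _ _)) => //.
- by move=> s sI; rewrite [RHS]wpath_cons.
- exact: continuous_split_time.
- exact: continuous_idfun.
- by rewrite split_time0.
- by rewrite split_time1.
- by move=> s sI; have [] := split_timeP n0 sI.
Qed.

Lemma evalw_from_cat g u v : evalw_from g (u ++ v) = evalw_from (evalw_from g u) v.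
Proof. by elim: u g => //= l u IH g; rewrite IH. Qed.

Lemma homotopic_wpath_cat g u v : homotopic (@wpath R g (u ++ v))
  (pconcat (wpath g u) (wpath (evalw_from g u) v)).
Proof.
elim: u g => [|l u IH] g /=.
  by rewrite wpath_nil; exact: homotopic_sym (concat_constl (wpath_path g v)).
set h := Fmul g (lval l); have pl := lpoint_path g l.
apply: homotopic_trans (homotopic_wpath_cons g l (u ++ v)) _.
apply: homotopic_trans (homotopic_concat pl (wpath_path h _) (homotopic_refl pl) (IH h)) _.
apply: homotopic_trans (homotopic_sym (concat_assoc pl (wpath_path h u) (wpath_path _ v))) _.
apply: (homotopic_concat (path_between_concat pl (wpath_path h u)) (wpath_path _ v)
  _ (homotopic_refl (wpath_path _ v))).
exact: homotopic_sym (homotopic_wpath_cons g l u).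
Qed.

Lemma Psi0_path w : path_between (V Fid) (V w) (@Psi0 R w).
Proof. by have := wpath_path Fid (Defs.eta w); rewrite evalw_eta. Qed.

Lemma continuous_P1 : continuous (@P1 R).
Proof. by apply/continuousP => U [oU _]; exact: oU. Qed.

Lemma continuous_face g r :
  continuous (fun z : R * R => face g r (clamp z.1, clamp z.2)).
Proof.
apply: (continuous_comp_within (A := sq01) (f := fun z : R * R => (clamp z.1, clamp z.2))).
- by cont.
- by move=> z; split; exact: clamp_itv.
- by apply/continuousP => U [_]; exact.
Qed.

Lemma relator_trivial g r :
  homotopic (@P1 R \o wpath g (relator r)) (fun=> P1 (V g)).
Proof.
have I0 : 0 <= (0 : R) <= 1 by rewrite lexx ler01.
have I1 : 0 <= (1 : R) <= 1 by rewrite lexx ler01.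
have [_ w0 w1] := wpath_path g (relator r); rewrite evalw_relator in w1.
pose H (z : R * R) := face g r (clamp z.1, clamp (1 - clamp z.2)).
have H0 s : 0 <= s <= 1 -> H (s, 0) = P1 (wpath g (relator r) s).
  by move=> sI; rewrite /H /face /= (clamp_id I0) subr0 (clamp_id I1) lexx clamp_id.
apply: (homotopic_eq (p := fun s => H (s, 0)) (q := fun=> H (0, 0))).
- exact: H0.
- by move=> s _; rewrite H0 // w0.
apply: (homotopic_const_of_free (x := Fc g r)).
- have cf : continuous (fun z : R * R => (z.1, 1 - clamp z.2) : R * R) by cont.
  exact: continuous_comp_all cf (@continuous_face g r).
- move=> s sI; rewrite /H /face /= (clamp_id I1) subrr (clamp_id I0) ler10 /=.
  by rewrite insubF ?ltxx.
- move=> t tI; rewrite /H /face /= (clamp_id I1) (clamp_id I0); case: ifP => _.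
    by rewrite w0 w1.
  case: (insub (clamp _)) => // rho.
  case: insubP => [s0' _ e0|]; last by rewrite lexx ltr01.
  case: insubP => [s1' + _|_]; first by rewrite ltxx andbF.
  by congr Fi; apply: val_inj.
Qed.

End Paths.

(** * Filling the edges *)

HB.instance Definition _ := gen_eqMixin tree.
HB.instance Definition _ := gen_choiceMixin tree.

Section Edges.

Definition letter_edge (g : F) (l : letter) : edge :=
  if l.2 then (Fmul g (gen l.1), l.1) else (g, l.1).

Lemma path_edges_cons g l v :
  path_edges g (l :: v) = letter_edge g l :: path_edges (Fmul g (lval l)) v.
Proof. by []. Qed.

Lemma path_edges_cat g u v :
  path_edges g (u ++ v) = path_edges g u ++ path_edges (evalw_from g u) v.
Proof. by elim: u g => //= l u IH g; rewrite IH. Qed.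

Lemma In_seqP (T : eqType) (x : T) (s : seq T) : In_seq x s <-> x \in s.
Proof.
elim: s => [//|y s IH] /=; rewrite inE IH; split.
  by case=> [->|->]; rewrite ?eqxx ?orbT.
by case/orP => [/eqP->|]; auto.
Qed.

Lemma path_edges_split g v e : In_seq e (path_edges g v) ->
  exists u l w, v = u ++ l :: w /\ e = letter_edge (evalw_from g u) l.
Proof.
elim: v g => [//|l v IH] g; rewrite path_edges_cons /= => -[<-|].
  by exists [::], l, v.
by move/IH => [u [l' [w [-> ->]]]]; exists (l :: u), l', w.
Qed.

Lemma path_edges_mul g h v :
  path_edges (Fmul g h) v = [seq (Fmul g e.1, e.2) | e <- path_edges h v].
Proof.
by elim: v h => //= -[a b] v IH h; rewrite -!FmulA IH; case: b.
Qed.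

Fixpoint tree_code (t : tree) : seq bool :=
  if t is Node a b then true :: tree_code a ++ tree_code b else [:: false].

Definition edge_code (e : edge) : seq bool * seq bool * bool :=
  (tree_code (Tminus e.1), tree_code (Tplus e.1), e.2).

Lemma Fmul_injr (g : F) : injective (Fmul g).
Proof.
move=> h k /(congr1 stream_act); rewrite !stream_actM => e; apply: stream_act_inj.
have fK : stream_act (mkF (reduce (Tplus g, Tminus g))) \o stream_act g = id.
  have [r e'] := @reduce_spec (Tplus g, Tminus g) (esym (balanced g)).
  rewrite /stream_act sval_mkF // e' [sval g]surjective_pairing tact_trans ?tact_id //.
  by rewrite /leaves balanced.
rewrite -[stream_act h]/(id \o stream_act h) -[stream_act k]/(id \o stream_act k).
by rewrite -fK -!compA e.
Qed.

Lemma uniq_relator_edges g r : uniq (path_edges g (relator r)).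
Proof.
rewrite -(Fmul1 g) path_edges_mul map_inj_uniq; last first.
  by move=> [h a] [k b] /= [/Fmul_injr -> ->].
apply: (@map_uniq _ _ edge_code).
by case: r; vm_compute.
Qed.

End Edges.

Section Filling.
Context {R : realType}.
Implicit Types (g h w : F) (a : bool) (l : letter) (u v : word).

Definition filled g l : Prop :=
  homotopic (pconcat (@P1 R \o Psi0 g) (P1 \o lpoint g l)) (P1 \o Psi0 (Fmul g (lval l))).

Definition filled_edge (e : edge) : Prop := filled e.1 (e.2, false).

Let spoke w := path_between_map (@continuous_P1 R) (Psi0_path w).
Let step g l := path_between_map (@continuous_P1 R) (lpoint_path g l).
Let walk g v := path_between_map (@continuous_P1 R) (wpath_path g v).

Lemma good_filled (e : edge) : @good_edge R e -> filled_edge e.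
Proof.
case: e => w a /homotopic_null_homotopic /(homotopic_map (@continuous_P1 R)).
rewrite /good_loop /= !pconcat_map.
exact: (concat_eq_of_loop (spoke w) (step w (a, false)) (spoke _)).
Qed.

Lemma filled_letter g l : filled_edge (letter_edge g l) <-> filled g l.
Proof.
case: l => a []; last by [].
rewrite /filled_edge /filled /= /lval /= FmulK lpoint_rev; split.
  move/(concat_eq_rev (spoke _) (path_between_rev (step g (a, true))) (spoke _)).
  apply: homotopic_eq => // s _; rewrite /pconcat /preverse /=.
  by case: ifP => // _; rewrite subKr.
exact: (concat_eq_rev (spoke _) (step g (a, true)) (spoke _)).
Qed.

Lemma filled_word g v :
  (forall e, In_seq e (path_edges g v) -> filled_edge e) ->
  homotopic (pconcat (@P1 R \o Psi0 g) (P1 \o wpath g v)) (P1 \o Psi0 (evalw_from g v)).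
Proof.
elim: v g => [|l v IH] g fe; first exact: (concat_constr (spoke g)).
rewrite path_edges_cons in fe.
have /filled_letter fl := fe (letter_edge g l) (or_introl (erefl _)).
have fv := IH (Fmul g (lval l)) (fun e ev => fe e (or_intror ev)).
apply: homotopic_trans fv.
have := homotopic_map (@continuous_P1 R) (homotopic_wpath_cons g l v).
rewrite pconcat_map => /(homotopic_concat (spoke g) (walk g (l :: v)) (homotopic_refl (spoke g))).
move/homotopic_trans; apply.
apply: homotopic_trans (homotopic_sym (concat_assoc (spoke g) (step g l) (walk _ v))) _.
apply: homotopic_concat (path_between_concat (spoke g) (step g l)) (walk _ v) fl _.
exact: homotopic_refl (walk _ v).
Qed.

Lemma filled_of_cell (e : edge) (c : cell) : on_boundary e c ->
  (forall f, on_boundary f c -> f <> e -> filled_edge f) -> filled_edge e.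
Proof.
case: c => g r /=; rewrite /on_boundary /= => /path_edges_split[u [l [v [er ->]]]] fe.
have := uniq_relator_edges g r; rewrite er path_edges_cat path_edges_cons.
set h := evalw_from g u in fe *; set k := Fmul h (lval l).
rewrite cat_uniq cons_uniq => /and3P[_ /hasPn nu /andP[nv _]].
have fu : forall f, In_seq f (path_edges g u) -> filled_edge f.
  move=> f /In_seqP fu; apply: fe.
    by apply/In_seqP; rewrite er path_edges_cat mem_cat fu.
  move=> ef; have := nu (letter_edge h l); rewrite inE eqxx /= -ef.
  by move=> /(_ isT) /negP; apply.
have fv : forall f, In_seq f (path_edges k v) -> filled_edge f.
  move=> f /In_seqP fv; apply: fe.
    by apply/In_seqP; rewrite er path_edges_cat mem_cat path_edges_cons inE fv !orbT.
  by move=> ef; rewrite -ef fv in nv.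
apply/filled_letter.
have kg : evalw_from k v = g by rewrite -[RHS](evalw_relator g r) er evalw_from_cat.
have {}fu := filled_word fu; have {}fv := filled_word fv; rewrite kg in fv.
have pv := walk k v; rewrite kg in pv.
apply: (concat_eq_of_trivial_loop (spoke g) (walk g u) (step h l) pv (spoke h) (spoke k)
  _ fu fv).
apply: homotopic_trans (relator_trivial g r); apply: homotopic_sym; rewrite er.
apply: homotopic_trans (homotopic_map (@continuous_P1 R) (homotopic_wpath_cat g u (l :: v))) _.
rewrite pconcat_map; apply: homotopic_concat (walk g u) (walk h (l :: v)) _ _.
  exact: homotopic_refl (walk g u).
by rewrite -pconcat_map; exact: homotopic_map (@continuous_P1 R) (homotopic_wpath_cons h l v).
Qed.

Lemma all_filled (le : edge -> edge -> Prop) (c : edge -> cell) :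
  (forall e f, @bad_edge R e -> @bad_edge R f -> le e f -> le f e -> e = f) ->
  (forall e f k : edge, @bad_edge R e -> @bad_edge R f -> @bad_edge R k ->
     le e f -> le f k -> le e k) ->
  (forall e, @bad_edge R e -> finite_set [set f | @bad_edge R f /\ le f e /\ f <> e]) ->
  (forall e, @bad_edge R e -> on_boundary e (c e)) ->
  (forall e f, @bad_edge R e -> @bad_edge R f -> on_boundary f (c e) -> f <> e ->
     le f e /\ f <> e) ->
  forall e, filled_edge e.
Proof.
move=> anti trans fin bc below.
pose B e := [set f | @bad_edge R f /\ le f e /\ f <> e].
suff H n e : @bad_edge R e -> (#|` fset_set (B e)| < n)%N -> filled_edge e.
  move=> e; have [ge|be] := EM (@good_edge R e); first exact: good_filled.
  exact: H be (ltnSn _).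
elim: n e => [//|n IH] e be cn; apply: (filled_of_cell (bc e be)) => f fc fe.
have [gf|bf] := EM (@good_edge R f); first exact: good_filled.
have [lfe _] := below e f be bf fc fe.
rewrite ltnS in cn; apply: (IH f bf); apply: leq_trans cn; apply: fproper_ltn_card.
rewrite fproperEneq; apply/andP; split; last first.
  apply/fsubsetP => h; rewrite !in_fset_set; try exact: fin.
  rewrite !inE => -[bh [lhf hf]]; split=> //; split; first exact: trans lhf lfe.
  by move=> he; apply: hf; apply: anti => //; rewrite he.
apply/eqP => ee; have : f \in fset_set (B f).
  by rewrite ee in_fset_set; [rewrite inE | exact: fin].
by rewrite in_fset_set; [rewrite inE => -[_ []] | exact: fin].
Qed.

End Filling.

Section Combing.
Context {R : realType}.

Lemma open_forall_segment (T : topologicalType) (f : R * R -> T) (O : set T) (b c : R) :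
  continuous f -> open O -> open [set s | forall t, b <= t <= c -> O (f (s, t))].
Proof.
move=> cf oO; rewrite openE => s sO.
have /compact_near_coveringP cover := @segment_compact R b c.
have := cover R (nbhs s) (fun s' t' => O (f (s', t'))) _.
rewrite /interior /=; apply => t' bt; rewrite in_itv /= in bt.
have [[A B] /= [nA nB] AB] := cf (s, t') O (open_nbhs_nbhs (conj oO (sO t' bt))).
by exists (B, A) => //= -[t'' s''] [Bt As]; exact: (AB (s'', t'')).
Qed.

Lemma epoint_surj (y : X1 R) : exists g a s, 0 <= s <= 1 /\ y = epoint g a s.
Proof.
case: y => [g|g a [s sI]].
  by exists g, false, 0; rewrite epoint0 lexx ler01.
exists g, a, s; have /andP[/ltW -> /ltW ->] := sI; split=> //.
by rewrite /epoint insubT.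
Qed.

(* [X1] carries the quotient topology of its edges; as [R] is locally compact, so does the
   product [X1 * R]. *)
Lemma continuous_on_edges (T : topologicalType) (f : X1 R * R -> T) :
  (forall g a, continuous (fun z : R * R => f (epoint g a (clamp z.1), z.2))) ->
  continuous f.
Proof.
move=> cf [x t] W nW; pose O := interior W.
have oO : open O := @open_interior _ W.
have [g [a [s [sI es]]]] := epoint_surj x.
have ct : continuous (fun t' : R => f (x, t')).
  have cs : continuous (fun t' : R => (s, t') : R * R) by cont.
  have := continuous_comp_all cs (cf g a).
  by rewrite es; rewrite /comp /= clamp_id.
have [d /= d0 dO] : \forall t' \near t, O (f (x, t')).
  by apply: (ct t O); apply: open_nbhs_nbhs; split=> //; exact: nW.
pose J t' := t - d / 2 <= t' <= t + d / 2.
have JO t' : J t' -> O (f (x, t')).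
  by move=> /andP[h1 h2]; apply: dO => /=; rewrite ltr_norml; apply/andP; split; lra.
pose U : set (X1 R) := [set y | forall t', J t' -> O (f (y, t'))].
have oU : open U.
  move=> h b; apply/open_subspaceP.
  exists [set s : R | forall t', J t' -> O (f (epoint h b (clamp s), t'))].
    exact: (open_forall_segment (cf h b)).
  by apply/seteqP; split=> r /= [rO rI]; split=> // t' /rO; rewrite clamp_id.
exists (U, [set t' | J t']) => /=; last first.
  by move=> [y t'] [/= yO tJ]; exact: interior_subset (yO _ tJ).
split; first by apply: open_nbhs_nbhs.
exists (d / 2) => /=; first by rewrite divr_gt0.
by move=> t' /=; rewrite ltr_norml /J => /andP[h1 h2]; apply/andP; split; lra.
Qed.

Lemma edge_square (g : F) (a : bool) : filled_edge (R := R) (Fmul g (gen a), a) ->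
  exists h : R * R -> X2 R, [/\ continuous h,
    (forall s, 0 <= s <= 1 -> h (s, 0) = P1 (V Fid)),
    (forall s, 0 <= s <= 1 -> h (s, 1) = P1 (epoint g a s)) &
    (forall t, 0 <= t <= 1 -> h (0, t) = P1 (Psi0 g t) /\
                              h (1, t) = P1 (Psi0 (Fmul g (gen a)) t))].
Proof.
move/(filled_letter g (a, true)) => fg.
have spoke w := path_between_map (@continuous_P1 R) (Psi0_path w).
have step := path_between_map (@continuous_P1 R) (lpoint_path g (a, true)).
exact: square_of_trivial_loop (spoke g) step (spoke _)
  (loop_of_concat_eq (spoke g) step (spoke _) fg).
Qed.

End Combing.

Theorem theorem4p2 (R : realType) (le : edge -> edge -> Prop) (c : edge -> cell) :
  (* (1) le is a partial ordering of the set B of bad edges ... *)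
  (forall e, @bad_edge R e -> le e e) ->
  (forall e f, @bad_edge R e -> @bad_edge R f -> le e f -> le f e -> e = f) ->
  (forall e f g, @bad_edge R e -> @bad_edge R f -> @bad_edge R g ->
     le e f -> le f g -> le e g) ->
  (* ... with finitely many bad edges below each bad edge *)
  (forall e, @bad_edge R e ->
     finite_set [set f | @bad_edge R f /\ le f e /\ f <> e]) ->
  (* (2) c : B -> 2-cells *)
  (forall e, @bad_edge R e -> on_boundary e (c e)) ->
  (forall e f, @bad_edge R e -> @bad_edge R f -> on_boundary f (c e) -> f <> e ->
     le f e /\ f <> e) ->
  exists Psi : X1 R * R -> X2 R, is_1combing Psi /\ extends_Psi0 Psi.
Proof.
move=> _ anti trans fin bc below.
have fe := all_filled anti trans fin bc below.
have /choice[h hP] : forall e : edge, exists h : R * R -> X2 R, [/\ continuous h,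
    (forall s, 0 <= s <= 1 -> h (s, 0) = P1 (V Fid)),
    (forall s, 0 <= s <= 1 -> h (s, 1) = P1 (epoint e.1 e.2 s)) &
    (forall t, 0 <= t <= 1 -> h (0, t) = P1 (Psi0 e.1 t) /\
                              h (1, t) = P1 (Psi0 (Fmul e.1 (gen e.2)) t))].
  by move=> [g a]; exact: edge_square (fe _).
pose Psi (z : X1 R * R) : X2 R := match z.1 with
  | V w => P1 (Psi0 w z.2)
  | E g a s => h (g, a) (sval s, z.2)
  end.
have I0 : 0 <= (0 : R) <= 1 by rewrite lexx ler01.
have I1 : 0 <= (1 : R) <= 1 by rewrite lexx ler01.
have PsiE g a s t : 0 <= s <= 1 -> 0 <= t <= 1 -> Psi (epoint g a s, t) = h (g, a) (s, t).
  move=> sI tI; have [_ _ _ hE] := hP (g, a); have [h0 h1] := hE t tI.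
  rewrite /Psi /epoint /=; case: insubP => [s' _ <- //|].
  rewrite negb_and -!leNgt; have [s0' _|s0'] /= := leP s 0.
    by have -> : s = 0; [lra | rewrite h0].
  by move=> s1'; have -> : s = 1; [lra | rewrite h1].
exists Psi; split; last by [].
split.
- pose Psi' (z : X1 R * R) := Psi (z.1, clamp z.2).
  have cPsi' : continuous Psi'.
    apply: continuous_on_edges => g a.
    have -> : (fun z : R * R => Psi' (epoint g a (clamp z.1), z.2)) =
        h (g, a) \o (fun z : R * R => (clamp z.1, clamp z.2)).
      by apply: funext => z; rewrite /Psi' /= PsiE ?clamp_itv.
    have [ch _ _ _] := hP (g, a).
    have cc : continuous (fun z : R * R => (clamp z.1, clamp z.2) : R * R) by cont.
    exact: continuous_comp_all cc ch.
  apply: subspace_eq_continuous (continuous_subspaceT cPsi') => -[x t].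
  by rewrite inE /from_subspace /Psi' /= => tI; rewrite clamp_id.
- case=> [w|g a s]; first by have [_ e _] := Psi0_path (R := R) w; rewrite /Psi /= e.
  by have [_ e _ _] := hP (g, a); rewrite /Psi /= e //; case: s => s /= /andP[/ltW -> /ltW ->].
- case=> [w|g a s]; first by have [_ _ e] := Psi0_path (R := R) w; rewrite /Psi /= e.
  have [_ _ e _] := hP (g, a); case: s => s sI; have /andP[/ltW s0' /ltW s1'] := sI.
  by rewrite /Psi /= e ?s0' //=; congr P1; rewrite /epoint insubT.
- by move=> w t _; exists (Psi0 w t).
Qed.
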